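(* Let $\mathcal H$ be a separable Hilbert space, let $T=(T_1,\ldots,T_n)\in\mathcal D^c_{\boldsymbol\mu}(\mathcal H)$ and let $\Psi_T:F_s^\infty(\boldsymbol\mu)\to B(\mathcal H)$ be defined by $$\Psi_T(\varphi(B))=\varphi(T):=\text{SOT-}\lim_{N\to\infty}\sum_{\mathbf k\in\mathbb N_0^n,\,|\mathbf k|\le N}\Big(1-\frac{|\mathbf k|}{N+1}\Big)c_{\mathbf k}T^{\mathbf k},$$ where $\varphi(B)\in F_s^\infty(\boldsymbol\mu)$ has the Fourier representation $\sum_{\mathbf k\in\mathbb N_0^n}c_{\mathbf k}B^{\mathbf k}$. Then $\Psi_T$ (is well defined and) has the following properties. (i) $\Psi_T\big(\sum_{|\alpha|\le m}c_\alpha B_\alpha\big)=\sum_{|\alpha|\le m}c_\alpha T_\alpha$ for $m\in\mathbb N$. (ii) $\Psi_T$ is sequentially WOT-continuous (resp. SOT-continuous). (iii) $\Psi_T$ is a completely bounded algebra homomorphism and $\|\Psi_T\|_{cb}\le\big\|\sum_{\mathbf k\in\mathbb N_0^n}\omega_{\mathbf k}T^{\mathbf k}(T^{\mathbf k})^*\big\|^{1/2}$. (iv) $\Psi_T$ is $w^*$-continuous. (v) $r(\varphi(T))\le r(\varphi(B))$ for any $\varphi(B)\in F_s^\infty(\boldsymbol\mu)$, where $r(X)$ denotes the spectral radius of $X$.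
   Context: $\mathbb F_n^+$ is the unital free semigroup on generators $g_1,\ldots,g_n$ with identity $g_0$; $|\alpha|$ is the length of $\alpha$. $F^2(H_n)$ is the full Fock space, a Hilbert space with orthonormal basis $\{e_\alpha\}_{\alpha\in\mathbb F_n^+}$, $1:=e_{g_0}$. For $\alpha=g_{i_1}\cdots g_{i_k}$: $\lambda_\alpha:=\lambda_{i_1}\cdots\lambda_{i_k}$, $T_\alpha:=T_{i_1}\cdots T_{i_k}$, $\boldsymbol\mu(\alpha,g_0):=\mu_{g_{i_1}\cdots g_{i_k}}\mu_{g_{i_2}\cdots g_{i_k}}\cdots\mu_{g_{i_k}}$; for $g_0$ these are $1$, $I$, $1$. Standing assumptions: $\boldsymbol\mu=\{\mu_\beta\}_{|\beta|\ge1}$ is strictly positive; for each $i$, $\sup_\alpha\mu_{g_i\alpha}<\infty$ and $\sup_\alpha\boldsymbol\mu(\alpha g_i,g_0)/\boldsymbol\mu(\alpha,g_0)<\infty$; and $\mathcal D(\boldsymbol\mu):=\{\lambda\in\mathbb C^n:\sum_\alpha|\lambda_\alpha|^2/\boldsymbol\mu(\alpha,g_0)^2<\infty\}$ contains a neighborhood of the origin. $W_ie_\alpha:=\mu_{g_i\alpha}e_{g_i\alpha}$. For $\mathbf k\in\mathbb N_0^n$, $|\mathbf k|:=k_1+\cdots+k_n$, $\lambda^{\mathbf k}:=\lambda_1^{k_1}\cdots\lambda_n^{k_n}$ (similarly $T^{\mathbf k},B^{\mathbf k}$), $\Lambda_{\mathbf k}:=\{\alpha:\lambda_\alpha=\lambda^{\mathbf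 k}\ \forall\lambda\in\mathbb C^n\}$, $\omega_{\mathbf k}:=\sum_{\alpha\in\Lambda_{\mathbf k}}\boldsymbol\mu(\alpha,g_0)^{-2}$, $y^{(\mathbf k)}:=\frac1{\omega_{\mathbf k}}\sum_{\alpha\in\Lambda_{\mathbf k}}\frac1{\boldsymbol\mu(\alpha,g_0)}e_\alpha$. $F_s^2(\boldsymbol\mu)$ is the closed span of the orthogonal vectors $y^{(\mathbf k)}$; $B_i:=P_{F_s^2(\boldsymbol\mu)}W_i|_{F_s^2(\boldsymbol\mu)}$ (commuting operators). $F_s^\infty(\boldsymbol\mu)$ is the $w^*$-closed non-self-adjoint algebra generated by $B_1,\ldots,B_n$ and the identity; if $A\in F_s^\infty(\boldsymbol\mu)$ and $A1=\sum_{\mathbf k}c_{\mathbf k}y^{(\mathbf k)}$, then $\sum_{\mathbf k}c_{\mathbf k}B^{\mathbf k}$ is its Fourier representation, which determines $A$ uniquely. $\mathcal D^c_{\boldsymbol\mu}(\mathcal H)$ is the set of $n$-tuples $T\in B(\mathcal H)^n$ of mutually commuting operators for which $\sum_{\alpha}\frac1{\boldsymbol\mu(\alpha,g_0)^2}T_\alpha T_\alpha^*$, equivalently $\sum_{\mathbf k}\omega_{\mathbf k}T^{\mathbf k}(T^{\mathbf k})^*$, converges in the weak operator topology. *)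

(* Defs.v *)
From HB Require Import structures.
From mathcomp Require Import all_boot all_order all_algebra finmap.
From mathcomp Require Import all_classical all_reals all_analysis.
From mathcomp Require Import complex.
From mathcomp Require analysis.showcase.summability.

Set Implicit Arguments.
Unset Strict Implicit.
Unset Printing Implicit Defensive.
Import Order.TTheory GRing.Theory Num.Theory.
Import numFieldNormedType.Exports.

Local Open Scope classical_set_scope.
Local Open Scope ring_scope.
Local Open Scope complex_scope.

Reserved Notation "''B' ( H )" (at level 0, format "''B' ( H )").

(* The inner product is linear in its first argument. *)
HB.mixin Record NormedModule_hasInnerProduct (R : realType) H
    & NormedModule R[i] H := {
  ip : H -> H -> R[i] ;
  ip_linearl : forall (a : R[i]) (x y z : H),
    ip (a *: x + y) z = a * ip x z + ip y z ;
  ip_conj : forall x y : H, ip y x = (ip x y)^* ;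
  ip_norm : forall x : H, ip x x = `|x| ^+ 2 }.

#[short(type="hilbertType")]
HB.structure Definition Hilbert (R : realType) :=
  {H of CompleteNormedModule R[i] H & NormedModule_hasInnerProduct R H}.

(* Norms over [R[i]] take values in [R[i]]; this is the norm as a real. *)
Definition rnorm (R : realType) (V : normedZmodType R[i]) (v : V) : R :=
  complex.Re `|v|.

Definition separable (T : topologicalType) :=
  exists D : set T, countable D /\ dense D.

Section ClosedSpan.
Context {R : realType} {F : hilbertType R}.

Definition closed_submod (M : set F) :=
  [/\ closed M, M 0 & forall (a : R[i]) x y, M x -> M y -> M (a *: x + y)].

Definition cspan (S : set F) : set F := smallest closed_submod S.

Lemma cspan_closed_submod S : closed_submod (cspan S).
Proof.
split.
- apply: (@closed_bigI _ (set F) [set M | closed_submod M /\ S `<=` M] id).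
  by move=> M [[]].
- by move=> M [[]].
- move=> a x y Sx Sy M MS; case: (MS) => -[_ _ MD] _.
  by apply: MD; [exact: Sx|exact: Sy].
Qed.

Definition cspan_pred (S : set F) : {pred F} := fun x => `[< cspan S x >].

Record cspan_type (S : set F) := CSpan {
  cspan_val :> F ; _ : cspan_val \in cspan_pred S }.

Lemma cspan_submod S : submod_closed (cspan_pred S).
Proof.
have [_ S0 SD] := cspan_closed_submod S.
split; first exact/asboolP.
by move=> a x y /asboolP Sx /asboolP Sy; apply/asboolP; exact: SD.
Qed.

HB.instance Definition _ S :=
  GRing.isSubmodClosed.Build R[i] F (cspan_pred S) (cspan_submod S).
HB.instance Definition _ S := [isSub for @cspan_val S].
HB.instance Definition _ S := [Choice of cspan_type S by <:].
HB.instance Definition _ S := [SubChoice_isSubLmodule of cspan_type S by <:].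

Lemma cspan_normD S (x y : cspan_type S) : `|val (x + y)| <= `|val x| + `|val y|.
Proof. by rewrite raddfD ler_normD. Qed.

Lemma cspan_normZ S (l : R[i]) (x : cspan_type S) :
  `|val (l *: x)| = `|l| * `|val x|.
Proof. by rewrite linearZ normrZ. Qed.

Lemma cspan_norm0 S (x : cspan_type S) : `|val x| = 0 -> x = 0.
Proof. by move/normr0_eq0 => x0; apply/val_inj; rewrite x0 raddf0. Qed.

HB.instance Definition _ S := Lmodule_isNormed.Build R[i] (cspan_type S)
  (@cspan_normD S) (@cspan_normZ S) (@cspan_norm0 S).

Lemma cspan_complete (S : set F) (G : set_system (cspan_type S)) :
  ProperFilter G -> cauchy G -> cvg G.
Proof.
move=> FG /cauchyP Gc; have vc : cauchy (val @ G).
  apply/cauchyP => e /Gc[x Gx]; exists (val x).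
  have vb : forall y, ball x e y -> ball (val x) e (val y).
    by move=> y; rewrite -!ball_normE.
  exact: filterS vb Gx.
have /cvg_ex[l vl] : cvg (val @ G) by apply: cauchy_cvg.
have [Sclosed _ _] := cspan_closed_submod S.
have Sl : l \in cspan_pred S.
  apply/asboolP; apply: (@closed_cvg _ _ _ _ val (cspan S) Sclosed _ l vl).
  by apply: nearW => -[x xS]; exact/asboolP/xS.
apply/cvg_ex; exists (CSpan Sl); apply/cvgrPdist_lt => e e0.
have := vl => /cvgrPdist_lt /(_ e e0) vle; near=> y.
have -> : `|CSpan Sl - y| = `|l - val y|.
  by rewrite -[l]/(val (CSpan Sl)) -raddfB.
by near: y.
Unshelve. all: by end_near. Qed.

HB.instance Definition _ (S : set F) :=
  Uniform_isComplete.Build (cspan_type S) (@cspan_complete S).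

Lemma cspan_ip_linearl (S : set F) (a : R[i]) (x y z : cspan_type S) :
  ip (val (a *: x + y)) (val z) = a * ip (val x) (val z) + ip (val y) (val z).
Proof. by rewrite linearP ip_linearl. Qed.

HB.instance Definition _ (S : set F) := NormedModule_hasInnerProduct.Build R (cspan_type S)
  (@cspan_ip_linearl S) (fun x y => ip_conj (val x) (val y))
  (fun x => ip_norm (val x)).

End ClosedSpan.

Section BoundedOperators.
Context {R : realType}.
Implicit Type H : hilbertType R.

Definition bounded_linear H : {pred H -> H} := fun f =>
  `[< linear f /\ exists M : R[i], forall x, `|f x| <= M * `|x| >].

Record bop H := Bop { bop_fun :> H -> H ; _ : bop_fun \in @bounded_linear H }.
Local Notation "''B' ( H )" := (bop H).

Lemma bounded_linear_submod H : submod_closed (@bounded_linear H).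
Proof.
split.
  apply/asboolP; split; first by move=> a x y; rewrite /= scaler0 addr0.
  by exists 0 => x; rewrite normr0 mul0r.
move=> a f g /asboolP[fl [M fM]] /asboolP[gl [N gN]]; apply/asboolP; split.
  move=> b x y; rewrite !fctE /= fl gl !scalerDr !scalerA (mulrC b).
  by rewrite !addrA; congr (_ + _); rewrite -!addrA; congr (_ + _); rewrite addrC.
exists (`|a| * M + N) => x; rewrite mulrDl -mulrA (le_trans (ler_normD _ _))//.
by rewrite lerD// normrZ ler_wpM2l.
Qed.

HB.instance Definition _ H := GRing.isSubmodClosed.Build R[i] (H -> H)
  (@bounded_linear H) (@bounded_linear_submod H).
HB.instance Definition _ H := [isSub for @bop_fun H].
HB.instance Definition _ H := [Choice of 'B(H) by <:].
HB.instance Definition _ H := [SubChoice_isSubLmodule of 'B(H) by <:].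

Lemma id_bounded_linear H : idfun \in @bounded_linear H.
Proof. by apply/asboolP; split=> //; exists 1 => x; rewrite mul1r. Qed.

Lemma comp_bounded_linear H (A B : 'B(H)) : A \o B \in @bounded_linear H.
Proof.
have /asboolP[Al [M AM]] := valP A; have /asboolP[Bl [N BN]] := valP B.
apply/asboolP; split=> [a x y|]; first by rewrite /= (Bl a) (Al a).
exists (`|M| * N) => x; apply: (le_trans (AM _)).
have Mr : M * `|B x| <= `|M| * `|B x|.
  have [->|x0] := eqVneq (`|B x|) 0; first by rewrite !mulr0.
  have Bx0 : 0 < `|B x| by rewrite lt_def x0 normr_ge0.
  rewrite ler_pM2r// real_ler_norm//.
  have := le_trans (normr_ge0 _) (AM (B x)).
  by rewrite pmulr_lge0// => /ger0_real.
apply: (le_trans Mr); rewrite -mulrA.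
by apply: ler_wpM2l; [exact: normr_ge0|exact: BN].
Qed.

Definition bop1 H : 'B(H) := Bop (id_bounded_linear H).
Definition bopM H (A B : 'B(H)) : 'B(H) := Bop (comp_bounded_linear A B).

Lemma bopMA H : associative (@bopM H).
Proof. by move=> A B C; exact: val_inj. Qed.
Lemma bop1M H : left_id (@bop1 H) (@bopM H).
Proof. by move=> A; exact: val_inj. Qed.
Lemma bopM1 H : right_id (@bop1 H) (@bopM H).
Proof. by move=> A; exact: val_inj. Qed.
Lemma bopMDl H : left_distributive (@bopM H) +%R.
Proof. by move=> A B C; exact: val_inj. Qed.
Lemma bopMDr H : right_distributive (@bopM H) +%R.
Proof.
move=> A B C; apply/val_inj/funext => x; have /asboolP[Al _] := valP A.
by have := Al 1 (B x) (C x); rewrite !scale1r.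
Qed.

(* [H] may be the zero space, hence [Pz]. *)
HB.instance Definition _ H := GRing.Zmodule_isPzRing.Build 'B(H)
  (@bopMA H) (@bop1M H) (@bopM1 H) (@bopMDl H) (@bopMDr H).

End BoundedOperators.

Notation "''B' ( H )" := (bop H).

Section OperatorNotions.
Context {R : realType}.
Implicit Type H : hilbertType R.

(* In this file [xget 0 P] stands for "the element satisfying [P]"; existence
   and uniqueness are classical: here, by the Riesz representation theorem. *)
Definition adj H (A : 'B(H)) : 'B(H) :=
  xget 0 [set B : 'B(H) | forall x y, ip (A x) y = ip x (B y)].

Definition opnorm H (A : 'B(H)) : R :=
  sup [set rnorm (A x) | x in [set x : H | rnorm x <= 1]].

Definition spectrum H (A : 'B(H)) : set R[i] :=
  [set l : R[i] | ~ exists B : 'B(H),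
    B * (A - l *: (1 : 'B(H))) = 1 /\ (A - l *: (1 : 'B(H))) * B = 1].

(* On the zero space the spectrum is empty and this is [sup set0 = 0]. *)
Definition spectral_radius H (A : 'B(H)) : R :=
  sup [set rnorm (l : R[i]^o) | l in spectrum A].

Definition sot H : topologicalType :=
  initial_topology (fun A : 'B(H) => (A : {ptws H -> H})).

Definition wot H : topologicalType :=
  initial_topology (fun A : 'B(H) =>
    (fun xy : H * H => ip (A xy.1) xy.2) : {ptws (H * H)%type -> R[i]^o}).

Definition l2 H :=
  {x : nat -> H | (\sum_(0 <= j <oo) (rnorm (x j) ^+ 2)%:E < +oo)%E}.

(* [B(H)] is the dual of the trace class operators, which are the sums
   [\sum_j x_j (x) y_j^*] with [x] and [y] square summable; the functional on
   [B(H)] given by such a sum is [A |-> \sum_j <A x_j, y_j>]. *)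
Definition wstar H : topologicalType :=
  initial_topology (fun A : 'B(H) =>
    (fun xy : l2 H * l2 H =>
       limn (series (fun j => ip (A (sval xy.1 j)) (sval xy.2 j) : R[i]^o)))
    : {ptws (l2 H * l2 H)%type -> R[i]^o}).

(* Limits along the net of finite partial sums. *)
Definition norm_sum (I : choiceType) H (x : I -> H) (s : H) :=
  summability.partial_sum x @ summability.totally --> s.

Definition wot_sum (I : choiceType) H (A : I -> 'B(H)) (S : 'B(H)) :=
  (summability.partial_sum A : {fset I} -> wot H) @ summability.totally
    --> (S : wot H).

Definition subalgebra H (M : set 'B(H)) :=
  [/\ M 1,
      forall (a : R[i]) A B, M A -> M B -> M (a *: A + B) &
      forall A B, M A -> M B -> M (A * B)].

Definition wstar_algebra H (G : set 'B(H)) : set 'B(H) :=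
  smallest [set M | subalgebra M /\ closed (M : set (wstar H))] G.

Definition algebra_hom H K (D : set 'B(H)) (f : 'B(H) -> 'B(K)) :=
  [/\ f 1 = 1,
      forall (a : R[i]) A B, D A -> D B -> f (a *: A + B) = a *: f A + f B &
      forall A B, D A -> D B -> f (A * B) = f A * f B].

(* The norm of an operator matrix acting on the Hilbert sum of [m] copies
   of [H]. *)
Definition mx_opnorm H m (A : 'M['B(H)]_m) : R :=
  sup [set Num.sqrt (\sum_(i < m) rnorm (\sum_(j < m) A i j (x j)) ^+ 2)
      | x in [set x : 'I_m -> H | \sum_(j < m) rnorm (x j) ^+ 2 <= 1]].

Definition cb_norm H K (D : set 'B(H)) (f : 'B(H) -> 'B(K)) : \bar R :=
  ereal_sup [set r | exists m (A : 'M['B(H)]_m),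
    [/\ forall i j, D (A i j), mx_opnorm A <= 1 &
        r = (mx_opnorm (map_mx f A))%:E]].

Definition completely_bounded H K (D : set 'B(H)) (f : 'B(H) -> 'B(K)) :=
  (cb_norm D f < +oo)%E.

(* Orthogonal projection onto [cspan S], valued in the subspace itself. *)
Definition proj (F : hilbertType R) (S : set F) (x : F) : cspan_type S :=
  xget 0 [set y | forall z : cspan_type S, ip (x - val y) (val z) = 0].

Definition compression (F : hilbertType R) (S : set F) (W : 'B(F)) :
    'B(cspan_type S) :=
  xget 0 [set B : 'B(cspan_type S) | forall x, B x = proj S (W (val x))].

Definition orthonormal_basis (I : eqType) H (e : I -> H) :=
  (forall a b, ip (e a) (e b) = (a == b)%:R) /\ cspan (range e) = setT.

End OperatorNotions.

Definition seq_continuous_on (X Y : topologicalType) (D : set X) (f : X -> Y) :=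
  forall (u : nat -> X) (x : X), (forall k, D (u k)) -> D x ->
    u @ \oo --> x -> (f \o u) @ \oo --> f x.

(* The word [g_{i_1} ... g_{i_k}] is the sequence [[:: i_1; ...; i_k]]. *)
Definition word n := seq 'I_n.
Definition mindex n := {ffun 'I_n -> nat}.

Section Words.
Context {n : nat}.

Definition deg (k : mindex n) : nat := (\sum_(i < n) k i)%N.

Definition wordpow (A : pzRingType) (T : 'I_n -> A) (a : word n) : A :=
  \prod_(i <- a) T i.

Definition monom (A : pzRingType) (T : 'I_n -> A) (k : mindex n) : A :=
  \prod_(i < n) T i ^+ k i.

End Words.

Section Weights.
Context {R : realType} {n : nat}.
(* The value of [mu] at the empty word is irrelevant. *)
Variable mu : word n -> R.

Fixpoint bmu (a : word n) : R :=
  if a is i :: b then mu a * bmu b else 1.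

Definition Dmu : set 'rV[R[i]^o]_n :=
  [set l | (\esum_(a in [set: word n])
    (rnorm (wordpow (l ord0) a) ^+ 2 / bmu a ^+ 2)%:E < +oo)%E].

Definition admissible_weights :=
  [/\ forall i a, 0 < mu (i :: a),
      forall i, has_ubound (range (fun a => mu (i :: a))),
      forall i, has_ubound (range (fun a => bmu (rcons a i) / bmu a)) &
      nbhs (0 : 'rV[R[i]^o]_n) Dmu].

Definition Lambda (k : mindex n) : set (word n) :=
  [set a | forall l : 'I_n -> R[i], wordpow l a = monom l k].

Definition omega (k : mindex n) : R := \sum_(a \in Lambda k) bmu a ^- 2.

Section Fock.
Context {F : hilbertType R}.
Variable e : word n -> F.

(* Weighted left creation operator; bounded because [mu (i :: a)] is bounded
   in [a]. *)
Definition shift (i : 'I_n) : 'B(F) :=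
  xget 0 [set W : 'B(F) | forall a, W (e a) = (mu (i :: a))%:C *: e (i :: a)].

Definition yvec (k : mindex n) : F :=
  (omega k)^-1%:C *: \sum_(a \in Lambda k) (bmu a)^-1%:C *: e a.

Definition Fs : hilbertType R := cspan_type (range yvec).

Lemma yvec_Fs k : yvec k \in cspan_pred (range yvec).
Proof. by apply/asboolP => M [_]; apply; exists k. Qed.

Definition ys (k : mindex n) : Fs := CSpan (yvec_Fs k).

Lemma Lambda0 : Lambda [ffun=> 0%N] = [set [::]].
Proof.
apply/seteqP; split=> [[//|i a] /= /(_ (fun=> 0))|a -> l].
  rewrite /wordpow /monom big_cons mul0r big1 => [/eqP|j _].
    by rewrite eq_sym oner_eq0.
  by rewrite ffunE expr0.
by rewrite /wordpow /monom big_nil big1// => j _; rewrite ffunE expr0.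
Qed.

Lemma yvec0 : yvec [ffun=> 0%N] = e [::].
Proof.
rewrite /yvec /omega Lambda0 !fsbig_set1 /= expr1n !invr1.
by rewrite !scale1r.
Qed.

Lemma vacuum_Fs : e [::] \in cspan_pred (range yvec).
Proof. by rewrite -yvec0 yvec_Fs. Qed.

Definition vacuum : Fs := CSpan vacuum_Fs.

Definition Bop_s (i : 'I_n) : 'B(Fs) := compression (range yvec) (shift i).

Definition Fs_infty : set 'B(Fs) := wstar_algebra (range Bop_s).

Definition fourier (A : 'B(Fs)) (c : mindex n -> R[i]) :=
  norm_sum (fun k => c k *: ys k) (A vacuum).

End Fock.

#[global] Arguments Fs_infty {F} e.

Section Variety.
Context {H : hilbertType R}.

Definition Dc : set ('I_n -> 'B(H)) :=
  [set T | (forall i j, T i * T j = T j * T i) /\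
    exists S : 'B(H), wot_sum (fun a : word n =>
      (bmu a ^- 2)%:C *: (wordpow T a * adj (wordpow T a))) S].

Definition fejer (c : mindex n -> R[i]) (T : 'I_n -> 'B(H)) (N : nat) : 'B(H) :=
  \sum_(k \in [set k : mindex n | (deg k <= N)%N])
    ((1 - (deg k)%:R / N.+1%:R) * c k) *: monom T k.

(* [Psi] is total; only its restriction to [Fs_infty] matters. *)
Definition is_calculus {F : hilbertType R} (e : word n -> F)
    (T : 'I_n -> 'B(H)) (Psi : 'B(Fs e) -> 'B(H)) :=
  forall A, Fs_infty e A ->
    (exists c, fourier A c) /\
    (forall c, fourier A c ->
       (fejer c T : nat -> sot H) @ \oo --> (Psi A : sot H)).

End Variety.
End Weights.

#[global] Arguments Fs_infty {R n} mu {F} e.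

(* Main.v *)
(* Writing [1] for the vacuum, the calculus is [Psi A = Phi (A 1)], where
   [Phi : F_s^2 -> B(H)] is the bounded linear map with [Phi y^(k) = T^k]. It
   exists, with norm at most [|S|^(1/2)] for [S = \sum_k omega_k T^k (T^k)^*],
   because [(sqrt omega_k T^k)_k] is a bounded row and the vectors
   [sqrt omega_k y^(k)] are an orthonormal basis of [F_s^2].
   Each functional [v |-> <Phi v h, g>] is an inner product with a fixed vector,
   which gives the WOT and w*-continuity; the same row bound with vector
   coefficients gives complete boundedness.
   As [B_i y^(k) = y^(k + e_i)], any [A] commuting with the [B_i] satisfies
   [Phi (A v) = Phi (A 1) (Phi v)]. The commutant of the [B_i] is w*-closed, so
   it contains [F_s^infty] and [Psi] is multiplicative. The commutant is also
   closed under inverses, hence the spectrum of [Psi A] is contained in that of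
   [A], and the spectral radius estimate needs no power-norm formula. *)

Require Import Defs.
From HB Require Import structures.
From mathcomp Require Import all_boot all_order all_algebra finmap.
From mathcomp Require Import all_classical all_reals all_analysis.
From mathcomp Require Import complex ring lra.
From mathcomp Require analysis.showcase.summability.

Set Implicit Arguments.
Unset Strict Implicit.
Unset Printing Implicit Defensive.
Import Order.TTheory GRing.Theory Num.Theory.
Import numFieldNormedType.Exports.

Local Open Scope classical_set_scope.
Local Open Scope ring_scope.
Local Open Scope complex_scope.

(** * Norms and inner products *)

(** The hypothesis controls adjoints only: the finite sums [\sum_k omega_k |(T^k)^* z|^2] are parts
    of a nonnegative sum converging to [<S z, z>]. The row bound is dual to this: for
    [z = \sum_k T^k h_k] one writes [|z|^2 = \sum_k <h_k, (T^k)^* z>] and absorbs the adjoint part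
    into the left side. What results bounds the squared norm, whence the exponent 1/2 in the
    constant. Limits of infinite sums are obtained pointwise from uniformly bounded families of
    linear maps, and an identity between bounded maps on [F_s^2] needs checking on the vectors
    [y^(k)] only. Notions defined by [xget] or [sup] have default values, so each of them comes with
    a proof that the defining set is nonempty, or bounded, before it is used. *)

Notation cmod a := (rnorm (a : _[i]^o)).

Section RealNorm.
Variable R : realType.

Lemma rnormE (V : normedZmodType R[i]) (v : V) : `|v| = (rnorm v)%:C.
Proof. by rewrite /rnorm RRe_real// normr_real. Qed.

Lemma rnorm_ge0 (V : normedZmodType R[i]) (v : V) : 0 <= rnorm v.
Proof. by rewrite -ler0c -rnormE. Qed.

Lemma rnorm0 (V : normedZmodType R[i]) : rnorm (0 : V) = 0.
Proof. by rewrite /rnorm normr0. Qed.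

Lemma rnorm_eq0 (V : normedZmodType R[i]) (v : V) : (rnorm v == 0) = (v == 0).
Proof. by rewrite -(normr_eq0 v) rnormE -(inj_eq (@complexI _)). Qed.

Lemma rnormN (V : normedZmodType R[i]) (v : V) : rnorm (- v) = rnorm v.
Proof. by rewrite /rnorm normrN. Qed.

Lemma rnorm_distC (V : normedZmodType R[i]) (v w : V) : rnorm (v - w) = rnorm (w - v).
Proof. by rewrite /rnorm distrC. Qed.

Lemma rnormD (V : normedZmodType R[i]) (v w : V) :
  rnorm (v + w) <= rnorm v + rnorm w.
Proof. by rewrite -lecR rmorphD /= -!rnormE ler_normD. Qed.

Lemma rnorm_sum (V : normedZmodType R[i]) (I : Type) (r : seq I) (f : I -> V) :
  rnorm (\sum_(i <- r) f i) <= \sum_(i <- r) rnorm (f i).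
Proof.
elim/big_ind2 : _ => [|x a y b xa yb|//]; first by rewrite rnorm0.
exact: le_trans (rnormD _ _) (lerD xa yb).
Qed.

Lemma rnormZ (V : normedModType R[i]) (a : R[i]) (v : V) :
  rnorm (a *: v) = cmod a * rnorm v.
Proof. by apply: complexI; rewrite rmorphM /= -!rnormE normrZ. Qed.

Lemma cmodM (a b : R[i]) : cmod (a * b) = cmod a * cmod b.
Proof. by apply: complexI; rewrite rmorphM /= -!rnormE normrM. Qed.

Lemma cmod_sqr (a : R[i]) : cmod a ^+ 2 = complex.Re a ^+ 2 + complex.Im a ^+ 2.
Proof. by apply: complexI; rewrite rmorphXn /= -rnormE -add_Re2_Im2. Qed.

Lemma cmod_real (a : R) : cmod a%:C = `|a|.
Proof.
apply: complexI; rewrite -rnormE normc_def /= expr0n addr0.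
by rewrite sqrtr_sqr.
Qed.

Lemma conjC_real (a : R) : (a%:C)^*%C = a%:C.
Proof. exact: conjc_real. Qed.

Lemma Re_le_cmod (a : R[i]) : complex.Re a <= cmod a.
Proof.
apply: (le_trans (ler_norm _)); rewrite -(@ler_pXn2r _ 2) ?nnegrE ?rnorm_ge0//.
by rewrite cmod_sqr real_normK ?num_real// lerDl sqr_ge0.
Qed.

Lemma mulcJ (a : R[i]) : a * a^*%C = (cmod a ^+ 2)%:C.
Proof.
by rewrite rmorphXn /= -rnormE -add_Re2_Im2; case: a => a b; simpc; congr (_ +i* _); ring.
Qed.

Lemma ReD (a b : R[i]) : complex.Re (a + b) = complex.Re a + complex.Re b.
Proof. by case: a; case: b. Qed.

Lemma ReN (a : R[i]) : complex.Re (- a) = - complex.Re a.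
Proof. by case: a. Qed.

Lemma ReZ (a : R) (b : R[i]) : complex.Re (a%:C * b) = a * complex.Re b.
Proof. by case: b => b c; simpc. Qed.

Lemma Re_sum (I : Type) (r : seq I) (f : I -> R[i]) :
  complex.Re (\sum_(i <- r) f i) = \sum_(i <- r) complex.Re (f i).
Proof.
elim/big_rec2 : _ => // i x y _ <-; exact: ReD.
Qed.

Lemma cvg_rnormP (V : normedModType R[i]) (T : Type) (F : set_system T)
    (FF : Filter F) (f : T -> V) (y : V) :
  f @ F --> y <->
  (forall e : R, 0 < e -> \forall x \near F, rnorm (y - f x) < e).
Proof.
split=> [/cvgrPdist_lt fy e e0|fy].
  have := fy e%:C; rewrite ltcR => /(_ e0); apply: filterS => x.
  by rewrite rnormE ltcR.
(* In the order of [R[i]], [0 < e] forces the imaginary part of [e] to vanish, so complex tolerances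
   reduce to positive reals. *)
apply/cvgrPdist_lt => e; case: e => e e'; rewrite ltcE /= => /andP[/eqP-> e0].
by move: (fy e e0); apply: filterS => x; rewrite rnormE ltcR.
Qed.

Lemma cauchy_rnorm (V : completeNormedModType R[i]) (F : set_system V)
    (FF : ProperFilter F) :
  (forall e : R, 0 < e -> exists x : V, \forall y \near F, rnorm (x - y) < e) ->
  cvg F.
Proof.
move=> Fe; apply: cauchy_cvg; apply/cauchyP => e.
case: e => e e'; rewrite ltcE /= => /andP[/eqP-> e0].
have [x xF] := Fe e e0; exists x; move: xF; apply: filterS => y.
by rewrite -ball_normE /ball_ /= rnormE ltcR.
Qed.

Lemma closed_rnorm (V : normedModType R[i]) (M : set V) :
  (forall x, (forall e : R, 0 < e -> exists2 y, M y & rnorm (x - y) < e) -> M x) ->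
  closed M.
Proof.
move=> Mx x cx; apply: Mx => e e0.
have e0' : 0 < e%:C by rewrite ltcR.
have [y [My]] := cx _ (nbhsx_ballx x _ e0').
by rewrite -ball_normE /ball_ /= rnormE ltcR; exists y.
Qed.

Lemma closedP_rnorm (V : normedModType R[i]) (M : set V) (x : V) : closed M ->
  (forall e : R, 0 < e -> exists2 y, M y & rnorm (x - y) < e) -> M x.
Proof.
move=> Mc xM; apply: Mc => B /nbhs_ballP[e /= e0 xB].
move: e e0 xB => [e e']; rewrite ltcE /= => /andP[/eqP-> e0] xB.
have [y My xy] := xM _ e0; exists y; split => //; apply: xB.
by rewrite -ball_normE /ball_ /= rnormE ltcR.
Qed.

End RealNorm.

Section InnerProduct.
Variables (R : realType) (H : hilbertType R).
Implicit Types (x y z : H) (a : R[i]).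

Lemma ipDl x y z : ip (x + y) z = ip x z + ip y z.
Proof. by have := ip_linearl 1 x y z; rewrite scale1r mul1r. Qed.

Lemma ip0l x : ip 0 x = 0.
Proof. by apply/(@addrI _ (ip 0 x)); rewrite -ipDl !addr0. Qed.

Lemma ipZl a x y : ip (a *: x) y = a * ip x y.
Proof. by have := ip_linearl a x 0 y; rewrite !addr0 ip0l addr0. Qed.

Lemma ipNl x y : ip (- x) y = - ip x y.
Proof. by rewrite -scaleN1r ipZl mulN1r. Qed.

Lemma ipBl x y z : ip (x - y) z = ip x z - ip y z.
Proof. by rewrite ipDl ipNl. Qed.

Lemma ipDr x y z : ip z (x + y) = ip z x + ip z y.
Proof. by rewrite ip_conj ipDl rmorphD /= -!ip_conj. Qed.

Lemma ip0r x : ip x 0 = 0.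
Proof. by rewrite ip_conj ip0l conjc0. Qed.

Lemma ipZr a x y : ip x (a *: y) = a^*%C * ip x y.
Proof. by rewrite ip_conj ipZl rmorphM /= -ip_conj. Qed.

Lemma ipNr x y : ip x (- y) = - ip x y.
Proof. by rewrite ip_conj ipNl rmorphN /= -ip_conj. Qed.

Lemma ipBr x y z : ip z (x - y) = ip z x - ip z y.
Proof. by rewrite ipDr ipNr. Qed.

Lemma ip_suml (I : Type) (r : seq I) (P : pred I) (f : I -> H) y :
  ip (\sum_(i <- r | P i) f i) y = \sum_(i <- r | P i) ip (f i) y.
Proof. by elim/big_rec2 : _ => [|i a b _ <-]; [rewrite ip0l|rewrite ipDl]. Qed.

Lemma ip_sumr (I : Type) (r : seq I) (P : pred I) (f : I -> H) y :
  ip y (\sum_(i <- r | P i) f i) = \sum_(i <- r | P i) ip y (f i).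
Proof. by elim/big_rec2 : _ => [|i a b _ <-]; [rewrite ip0r|rewrite ipDr]. Qed.

Lemma ipxx x : ip x x = (rnorm x ^+ 2)%:C.
Proof. by rewrite ip_norm rmorphXn /= -rnormE. Qed.

Lemma Re_ipC x y : complex.Re (ip x y) = complex.Re (ip y x).
Proof. by rewrite ip_conj; case: (ip y x). Qed.

Lemma rnormD_sqr x y :
  rnorm (x + y) ^+ 2 = rnorm x ^+ 2 + 2 * complex.Re (ip x y) + rnorm y ^+ 2.
Proof.
have -> : rnorm (x + y) ^+ 2 = complex.Re (ip (x + y) (x + y)) by rewrite ipxx.
by rewrite ipDl !ipDr !ReD !ipxx /= (Re_ipC y x); ring.
Qed.

Lemma cauchy_schwarz x y : cmod (ip x y) <= rnorm x * rnorm y.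
Proof.
have [->|y0] := eqVneq y 0; first by rewrite ip0r !rnorm0 mulr0.
have b0 : 0 < rnorm y by rewrite lt_def rnorm_eq0 y0 rnorm_ge0.
(* This vector is [|y|^2] times the component of [x] orthogonal to [y]; the scaling avoids a
   division. *)
have := sqr_ge0 (rnorm ((rnorm y ^+ 2)%:C *: x + (- ip x y) *: y)).
rewrite rnormD_sqr !rnormZ cmod_real rnormN ipZl ipZr ReZ.
rewrite rmorphN /= mulNr (mulrC (ip x y)^*%C) mulcJ !exprMn real_normK ?num_real//.
set a := cmod _; set u := rnorm x; move: (rnorm y) b0 => v v0 h.
have {}h : 0 <= v ^+ 2 * (v ^+ 2 * u ^+ 2 - a ^+ 2).
  by move: h; rewrite /= (_ : - _ = - (a ^+ 2)) //; congr (0 <= _); ring.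
rewrite -(@ler_pXn2r _ 2) ?nnegrE ?rnorm_ge0 ?mulr_ge0 ?rnorm_ge0 ?(ltW v0)//.
by move: h; rewrite pmulr_rge0 ?exprn_gt0// subr_ge0 exprMn mulrC.
Qed.

Lemma ip_injr y z : (forall x, ip x y = ip x z) -> y = z.
Proof.
move=> h; apply/eqP; rewrite -subr_eq0 -rnorm_eq0 -sqrf_eq0.
by apply/eqP/complexI; rewrite -ipxx ipBr h subrr.
Qed.

Lemma ip_injl y z : (forall x, ip y x = ip z x) -> y = z.
Proof. by move=> h; apply: ip_injr => x; rewrite ip_conj h -ip_conj. Qed.

Lemma cvg_ipl (T : Type) (F : set_system T) (FF : Filter F) (f : T -> H) x y :
  f @ F --> x -> (fun t => ip (f t) y : R[i]^o) @ F --> (ip x y : R[i]^o).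
Proof.
move=> /cvg_rnormP fx; apply/cvg_rnormP => e e0.
(* The summand 1 keeps the divisor positive when [y = 0]; the same device recurs below as
   [C + 1]. *)
have y0 : 0 < 1 + rnorm y by rewrite ltr_pwDl ?rnorm_ge0.
have := fx _ (divr_gt0 e0 y0); apply: filterS => t ht.
rewrite -ipBl (le_lt_trans (cauchy_schwarz _ _))//.
rewrite (@le_lt_trans _ _ (rnorm (x - f t) * (1 + rnorm y)))//.
  by rewrite ler_wpM2l ?rnorm_ge0// lerDr.
by rewrite -ltr_pdivlMr.
Qed.

End InnerProduct.

(** * Bounded linear maps and the Riesz representation theorem *)

(** Closes the approximation arguments: an error of at most a fixed multiple of every [e] can be
    discarded. If [x] were positive, [e = x / (C + 1)] would give [x < x]. *)
Lemma le0_eps (R : realType) (x C : R) : 0 <= C ->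
  (forall e, 0 < e -> x <= C * e) -> x <= 0.
Proof.
move=> C0 xC; rewrite leNgt; apply/negP => x0.
have C1 : 0 < C + 1 by rewrite ltr_wpDl.
have := xC _ (divr_gt0 x0 C1); rewrite leNgt => /negP; apply.
by rewrite mulrCA gtr_pMr// ltr_pdivrMr// mul1r ltrDl.
Qed.

Section LinearMaps.
Variable R : realType.
Implicit Types X K : hilbertType R.

(** A real bound for maps that are not yet bundled as operators and may go from one space to
    another. *)
Definition rbounded X (V : normedModType R[i]) (C : R) (f : X -> V) :=
  forall x, rnorm (f x) <= C * rnorm x.

Lemma linear_fB (U V : lmodType R[i]) (f : U -> V) (x y : U) : linear f ->
  f (x - y) = f x - f y.
Proof.
by move=> fl; have := fl (-1) y x; rewrite !scaleN1r ![- _ + _]addrC.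
Qed.

Lemma linear_f0 (U V : lmodType R[i]) (f : U -> V) : linear f -> f 0 = 0.
Proof. by move=> fl; have := linear_fB 0 0 fl; rewrite !subrr. Qed.

Lemma linear_fD (U V : lmodType R[i]) (f : U -> V) (x y : U) : linear f ->
  f (x + y) = f x + f y.
Proof. by move=> fl; have := fl 1 x y; rewrite !scale1r. Qed.

Lemma linear_fZ (U V : lmodType R[i]) (f : U -> V) (a : R[i]) (x : U) :
  linear f -> f (a *: x) = a *: f x.
Proof. by move=> fl; have := fl a x 0; rewrite (linear_f0 fl) !addr0. Qed.

Lemma linear_fsum (U V : lmodType R[i]) (f : U -> V) (I : Type) (r : seq I)
    (P : pred I) (g : I -> U) : linear f ->
  f (\sum_(i <- r | P i) g i) = \sum_(i <- r | P i) f (g i).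
Proof.
move=> fl; elim/big_rec2 : _ => [|i a b _ <-]; first exact: linear_f0.
exact: linear_fD.
Qed.

Lemma cspan_ind X (S M : set X) : cspan S = setT -> closed_submod M ->
  S `<=` M -> forall x, M x.
Proof.
move=> ST cM SM x; have : cspan S x by rewrite ST.
by apply.
Qed.

(** The set where two bounded linear maps agree is a closed subspace. *)
Lemma eq_on_cspan X (V : normedModType R[i]) (S : set X) (f g : X -> V)
    (C D : R) : cspan S = setT -> linear f -> linear g ->
  0 <= C -> 0 <= D -> rbounded C f -> rbounded D g ->
  (forall s, S s -> f s = g s) -> f =1 g.
Proof.
move=> ST fl gl C0 D0 fC gD fg; apply: (cspan_ind ST) => //; split.
- apply: closed_rnorm => x xfg; apply/eqP; rewrite -subr_eq0 -rnorm_eq0.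
  rewrite eq_le rnorm_ge0 andbT; apply: (le0_eps (addr_ge0 C0 D0)) => e e0.
  have [y yfg xy] := xfg e e0.
  have -> : f x - g x = f (x - y) - g (x - y).
    rewrite (linear_fB _ _ fl) (linear_fB _ _ gl).
    by rewrite yfg opprB addrA subrK.
  apply: (le_trans (rnormD _ _)); rewrite rnormN mulrDl.
  by apply: lerD; [apply: (le_trans (fC _))|apply: (le_trans (gD _))];
    rewrite ler_wpM2l// ltW.
- by rewrite /= (linear_f0 fl) (linear_f0 gl).
- by move=> a x y /= fgx fgy; rewrite fl gl fgx fgy.
Qed.

(** * Pointwise limits of uniformly bounded families of linear maps *)

Section Net.
Variables (X K : hilbertType R) (I : Type) (F : set_system I).
Hypothesis FF : ProperFilter F.
Variables (L : I -> X -> K) (C : R).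
Hypotheses (Llin : forall i, linear (L i)) (C0 : 0 <= C)
  (LC : forall i, rbounded C (L i)).

(** The uniform bound gives [|L_i x - L_i y| <= C |x - y|] for all [i], so near a point [x] of the
    closure the limit at a close [y] serves as an approximate Cauchy centre. *)
Lemma closed_submod_cvg : closed_submod [set x | cvg (L^~ x @ F)].
Proof.
split.
- apply: closed_rnorm => x xL; apply: cauchy_rnorm => e e0.
  have C1 : 0 < C + 1 by rewrite ltr_wpDl.
  have e2 : 0 < e / 2 by rewrite divr_gt0.
  have [y /cvg_rnormP Ly xy] := xL _ (divr_gt0 e2 C1).
  exists (lim (L^~ y @ F)); have := Ly _ e2; apply: filterS => i Li /=.
  rewrite -[_ - _](subrKA (L i y)) (splitr e) (le_lt_trans (rnormD _ _))//.
  rewrite ltrD// -(linear_fB _ _ (Llin i)) (le_lt_trans (LC _ _))//.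
  rewrite rnorm_distC (@le_lt_trans _ _ ((C + 1) * rnorm (x - y)))//.
    by rewrite ler_wpM2r ?rnorm_ge0// lerDl.
  by rewrite mulrC -ltr_pdivlMr.
- rewrite /= (_ : L^~ 0 = fun=> 0); first exact: is_cvg_cst.
  by apply/funext => i; exact: linear_f0.
- move=> a x y /= xL yL.
  rewrite (_ : L^~ _ = (fun i => a *: L i x + L i y)); last first.
    by apply/funext => i; exact: Llin.
  by apply: is_cvgD => //; apply: is_cvgZr.
Qed.

(** Convergence spreads from [S] to its closed span, and linearity and the bound pass to the limit.
    The maps of [onb_extension] and [neumann] arise in this way. *)
Lemma cvg_net (S : set X) : cspan S = setT ->
  (forall s, S s -> cvg (L^~ s @ F)) ->
  exists l : X -> K,
    [/\ linear l, rbounded C l & forall x, L^~ x @ F --> l x].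
Proof.
move=> ST SL.
have Lcvg x : cvg (L^~ x @ F) := cspan_ind ST closed_submod_cvg SL x.
have Lex x : exists l : K, L^~ x @ F --> l by have := Lcvg x => /cvg_ex.
have [l lP] := choice Lex.
exists l; split => //.
- move=> a x y; apply: (cvg_unique _ (lP _)) => /=; first exact: norm_hausdorff.
  rewrite (_ : L^~ _ = (fun i => a *: L i x + L i y)); last first.
    by apply/funext => i; exact: Llin.
  by apply: cvgD; [apply: cvgZr; exact: lP|exact: lP].
- move=> x; rewrite -subr_le0; apply: (@le0_eps _ _ 1) => // e e0.
  have /cvg_rnormP/(_ e e0)/filter_ex[i Li] := lP x.
  rewrite mul1r lerBlDr -[in leLHS](subrK (L i x) (l x)).
  by rewrite (le_trans (rnormD _ _))// lerD ?(ltW Li)// LC.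
Qed.

(** For a limit known in advance, such as the identity for the Fejer means. *)
Lemma cvg_net_unique (S : set X) (l : X -> K) (D : R) : cspan S = setT ->
  linear l -> 0 <= D -> rbounded D l ->
  (forall s, S s -> L^~ s @ F --> l s) -> forall x, L^~ x @ F --> l x.
Proof.
move=> ST ll D0 lD SL x.
have [s Ss|l' [l'l l'C Ll']] := cvg_net ST _.
  by apply/cvg_ex; exists (l s); exact: SL.
suff -> : l x = l' x by [].
apply: (eq_on_cspan ST ll l'l D0 C0 lD l'C) => s Ss.
by apply: cvg_unique (SL s Ss) (Ll' s); exact: norm_hausdorff.
Qed.

End Net.

Section Riesz.
Variables (H : hilbertType R) (f : H -> R[i]) (C : R).
Hypotheses (flin : forall a x y, f (a *: x + y) = a * f x + f y)
  (fC : forall x, cmod (f x) <= C * rnorm x).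

Let J x := rnorm x ^+ 2 - 2 * complex.Re (f x).

Let fD x y : f (x + y) = f x + f y.
Proof. by have := flin 1 x y; rewrite scale1r mul1r. Qed.

Let fZ (a : R[i]) x : f (a *: x) = a * f x.
Proof.
have f0 : f 0 = 0 by apply: (@addrI _ (f 0)); rewrite -fD !addr0.
by have := flin a x 0; rewrite !addr0 f0 addr0.
Qed.

Let J_lb x : - C ^+ 2 <= J x.
Proof.
rewrite /J; have := le_trans (Re_le_cmod _) (fC x).
by have := sqr_ge0 (rnorm x - C); nra.
Qed.

Let J_parallelogram x y :
  J x + J y = 2 * J (2^-1%:C *: (x + y)) + rnorm (x - y) ^+ 2 / 2.
Proof.
rewrite /J rnormZ cmod_real fZ ReZ fD ReD exprMn !rnormD_sqr rnormN ipNr.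
by rewrite ReN ger0_norm ?invr_ge0//; field.
Qed.

(* The representing vector minimizes [|x|^2 - 2 Re f(x)], and a minimizing
   sequence is Cauchy by the parallelogram law. *)
Lemma riesz : exists y, forall x, f x = ip x y.
Proof.
have Jinf : has_inf (range J).
  split; first by exists (J 0), 0.
  by exists (- C ^+ 2) => _ [x _ <-]; exact: J_lb.
set m := inf (range J).
have Jm x : m <= J x by apply: ge_inf; [exact: Jinf.2|exists x].
have /choice[u uJ] : forall k : nat, exists x, J x < m + k.+1%:R^-1.
  move=> k; have k0 : (0 : R) < k.+1%:R^-1 by rewrite invr_gt0.
  by have [_ [x _ <-] xm] := inf_adherent k0 Jinf; exists x.
have uu i j : rnorm (u i - u j) ^+ 2 <= 2 * (i.+1%:R^-1 + j.+1%:R^-1).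
  have := J_parallelogram (u i) (u j); have := uJ i; have := uJ j.
  have := Jm (2^-1%:C *: (u i + u j)).
  move: (J _) (J _) (J _) (rnorm _ ^+ 2) (i.+1%:R^-1) (j.+1%:R^-1).
  by move: m {Jm uJ} => p a b c d k l; lra.
have inv0 (e : R) : 0 < e -> \forall k \near \oo, k.+1%:R^-1 < e.
  by move=> e0; exact: (near_infty_natSinv_lt (PosNum e0)).
have /cvg_ex[y /cvg_rnormP uy] : cvgn u.
  apply: cauchy_rnorm => e e0.
  have e4 : 0 < e ^+ 2 / 4 by rewrite divr_gt0 ?exprn_gt0.
  have [k ke] := filter_ex (inv0 _ e4); exists (u k).
  have := inv0 _ e4; apply: filterS => j /= je.
  rewrite -(@ltr_pXn2r _ 2) ?nnegrE ?rnorm_ge0 ?(ltW e0)//.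
  by rewrite (le_lt_trans (uu k j))//; move: (k.+1%:R^-1) (j.+1%:R^-1) ke je => a b; lra.
have Re_eq z : complex.Re (f z) = complex.Re (ip z y).
  set q := complex.Re (ip z y) - complex.Re (f z).
  (* First variation of [J] at its minimizer [y] in the direction [z]; it is derived from the points
     [u k], which minimize up to an error below [e]. *)
  suff h t : 0 <= t ^+ 2 * rnorm z ^+ 2 + 2 * t * q.
    apply/esym/eqP; rewrite -subr_eq0 -/q.
    have N0 : 0 < rnorm z ^+ 2 + 1 by rewrite ltr_wpDl ?sqr_ge0.
    (* At this [t] the quadratic is negative unless [q = 0]; the added 1 covers [z = 0]. *)
    have := h (- q / (rnorm z ^+ 2 + 1)).
    have -> : (- q / (rnorm z ^+ 2 + 1)) ^+ 2 * rnorm z ^+ 2 +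
        2 * (- q / (rnorm z ^+ 2 + 1)) * q =
      - (q ^+ 2 * ((rnorm z ^+ 2 + 2) / (rnorm z ^+ 2 + 1) ^+ 2)).
      by field; rewrite gt_eqF.
    rewrite oppr_ge0 pmulr_lle0.
      by rewrite le_eqVlt ltNge sqr_ge0 orbF sqrf_eq0.
    by rewrite divr_gt0 ?exprn_gt0// ltr_wpDl ?sqr_ge0.
  rewrite -oppr_le0; apply: (@le0_eps _ _ (1 + 2 * `|t| * rnorm z)).
    by rewrite addr_ge0// !mulr_ge0// rnorm_ge0.
  move=> e e0.
  have [k [ke uke]] : exists k, k.+1%:R^-1 < e /\ rnorm (y - u k) < e.
    have [k [? ?]] := filter_ex (filterI (inv0 _ e0) (uy _ e0)).
    by exists k.
  have := Jm (u k + t%:C *: z); have := uJ k; rewrite /J rnormD_sqr.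
  rewrite fD fZ ReD ReZ rnormZ cmod_real exprMn real_normK ?num_real//.
  rewrite ipZr conjC_real ReZ (Re_ipC _ z) => uk tz.
  have yu : `|t * (complex.Re (ip z y) - complex.Re (ip z (u k)))|
      <= `|t| * (rnorm z * e).
    rewrite normrM ler_wpM2l//.
    have -> : complex.Re (ip z y) - complex.Re (ip z (u k))
        = complex.Re (ip z (y - u k)).
      by rewrite ipBr; case: (ip z y); case: (ip z (u k)).
    have zy : cmod (ip z (y - u k)) <= rnorm z * e.
      by rewrite (le_trans (cauchy_schwarz _ _))// ler_wpM2l ?rnorm_ge0 ?(ltW uke).
    rewrite ler_norml (le_trans (Re_le_cmod _))// andbT.
    rewrite lerNl (le_trans _ zy)// -rnormN (le_trans _ (Re_le_cmod _))//.
    by case: (ip _ _).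
  move: yu; rewrite ler_norml => /andP[yu _].
  move: uk tz ke yu; rewrite /q.
  move: (complex.Re (ip z y)) (complex.Re (ip z (u k))) (complex.Re (f z)).
  move: (k.+1%:R^-1) (rnorm z) (rnorm (u k)) `|t| (complex.Re (f (u k))).
  move=> d nz nu nt fu a b c.
  by nra.
(* The real parts at [x] and at ['i *: x] determine the complex value. *)
exists y => x; have := Re_eq x; have := Re_eq ('i *: x).
rewrite fZ ipZl; case: (f x) => a b; case: (ip x y) => c d; simpc => /= + ->.
by move=> /oppr_inj ->.
Qed.

End Riesz.
End LinearMaps.

(** * Bounded operators and orthonormal bases *)

Section Operators.
Variable R : realType.
Implicit Type H : hilbertType R.

Lemma bop_linear H (A : 'B(H)) : linear A.
Proof. by have /asboolP[] := valP A. Qed.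

HB.instance Definition _ H (A : 'B(H)) :=
  GRing.isLinear.Build R[i] H H *:%R (A : H -> H) (bop_linear A).

Lemma bop_bounded H (A : 'B(H)) : exists2 C : R, 0 <= C & rbounded C A.
Proof.
(* The bound [M] is a priori complex; only its real part matters, and its modulus dominates that. *)
have /asboolP[_ [M AM]] := valP A; exists (cmod M); first exact: rnorm_ge0.
move=> x; have := AM x; rewrite !rnormE -/(bop_fun A).
rewrite mulrC lecE => /andP[_]; rewrite ReZ mulrC /= => /le_trans; apply.
by rewrite ler_wpM2r ?rnorm_ge0// Re_le_cmod.
Qed.

Lemma bop_exists H (f : H -> H) (C : R) : linear f -> rbounded C f ->
  exists A : 'B(H), forall x, A x = f x.
Proof.
move=> fl fC; have fb : f \in @bounded_linear R H.
  apply/asboolP; split => //; exists C%:C => x.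
  by rewrite !rnormE -rmorphM lecR.
by exists (Bop fb).
Qed.

Lemma bop_ext H (A B : 'B(H)) : (forall x, A x = B x) -> A = B.
Proof. by move=> AB; apply/val_inj/funext. Qed.

Lemma bopDE H (A B : 'B(H)) x : (A + B) x = A x + B x.
Proof. by []. Qed.

Lemma bopZE H a (A : 'B(H)) x : (a *: A) x = a *: A x.
Proof. by []. Qed.

Lemma bopNE H (A : 'B(H)) x : (- A) x = - A x.
Proof. by []. Qed.

Lemma bopME H (A B : 'B(H)) x : (A * B) x = A (B x).
Proof. by []. Qed.

Lemma bop1E H x : (1 : 'B(H)) x = x.
Proof. by []. Qed.

Lemma bop_sumE H (I : Type) (r : seq I) (P : pred I) (f : I -> 'B(H)) x :
  (\sum_(i <- r | P i) f i) x = \sum_(i <- r | P i) f i x.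
Proof. by elim/big_rec2 : _ => // i y z _ <-. Qed.

Lemma bop_scalerAl H a (A B : 'B(H)) : (a *: A) * B = a *: (A * B).
Proof. exact: bop_ext. Qed.

Lemma bop_scalerAr H a (A B : 'B(H)) : A * (a *: B) = a *: (A * B).
Proof. by apply: bop_ext => x; rewrite !(bopME, bopZE) linearZ. Qed.

Let adj_exists H (A : 'B(H)) :
  exists B : 'B(H), forall x y, ip (A x) y = ip x (B y).
Proof.
have [C C0 AC] := bop_bounded A.
have riesz_A y : exists z, forall x, ip (A x) y = ip x z.
  apply: (@riesz _ _ (fun x => ip (A x) y) (C * rnorm y)) => [a v w|v].
    by rewrite linearP ip_linearl.
  rewrite (le_trans (cauchy_schwarz _ _))// mulrAC.
  by rewrite ler_wpM2r ?rnorm_ge0.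
have [B AB] := choice riesz_A.
have Bl : linear B.
  move=> a v w; apply: ip_injr => u.
  by rewrite -AB !ipDr !ipZr !AB.
suff BC : rbounded C B.
  by have [B' B'B] := bop_exists Bl BC; exists B' => v w; rewrite B'B.
move=> z; have [->|Bz0] := eqVneq (B z) 0.
  by rewrite rnorm0 mulr_ge0// rnorm_ge0.
have Bz : 0 < rnorm (B z) by rewrite lt_def rnorm_eq0 Bz0 rnorm_ge0.
rewrite -(ler_pM2l Bz) -expr2.
have -> : rnorm (B z) ^+ 2 = complex.Re (ip (A (B z)) z) by rewrite AB ipxx.
rewrite (le_trans (Re_le_cmod _))// (le_trans (cauchy_schwarz _ _))//.
by rewrite mulrA (mulrC (rnorm (B z))) ler_wpM2r ?rnorm_ge0.
Qed.

(** Riesz representation makes the set defining [adj] nonempty, so [xget] does not return its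
    default 0. *)
Lemma adjP H (A : 'B(H)) x y : ip (A x) y = ip x (adj A y).
Proof.
have [B AB] := adj_exists A.
have := @xgetPex _ 0 [set B : 'B(H) | forall x y, ip (A x) y = ip x (B y)].
by apply; exists B.
Qed.

(** A set without a supremum has [sup] equal to 0 by default; this excludes that case, so that
    [opnorm] is a genuine bound. *)
Lemma opnorm_has_sup H (A : 'B(H)) :
  has_sup [set rnorm (A x) | x in [set x : H | rnorm x <= 1]].
Proof.
split; first by exists (rnorm (A 0)), 0; rewrite //= rnorm0.
have [C C0 AC] := bop_bounded A; exists C => _ [x /= x1 <-].
by rewrite (le_trans (AC x))// ler_piMr.
Qed.

Lemma opnorm_ge0 H (A : 'B(H)) : 0 <= opnorm A.
Proof.
apply: (@le_trans _ _ (rnorm (A 0))); first exact: rnorm_ge0.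
apply: sup_upper_bound; first exact: opnorm_has_sup.
by exists 0; rewrite //= rnorm0.
Qed.

Lemma opnormP H (A : 'B(H)) : rbounded (opnorm A) A.
Proof.
move=> x; have [->|x0] := eqVneq x 0.
  by rewrite linear0 !rnorm0 mulr0.
have x0' : 0 < rnorm x by rewrite lt_def rnorm_eq0 x0 rnorm_ge0.
rewrite -ler_pdivrMr//.
have -> : rnorm (A x) / rnorm x = rnorm (A ((rnorm x)^-1%:C *: x)).
  by rewrite linearZ rnormZ cmod_real ger0_norm ?invr_ge0 ?rnorm_ge0// mulrC.
apply: sup_upper_bound; first exact: opnorm_has_sup.
exists ((rnorm x)^-1%:C *: x) => //=.
by rewrite rnormZ cmod_real ger0_norm ?invr_ge0 ?rnorm_ge0// mulVf// gt_eqF.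
Qed.

End Operators.

#[local] Existing Instance summability.totally_filter.

(** * Orthogonal families, Bessel's inequality and expansions in a basis *)

Section Orthogonal.
Variables (R : realType) (X : hilbertType R) (I : choiceType).

Lemma pythagoras (v : I -> X) (r : seq I) :
  (forall i j, i != j -> ip (v i) (v j) = 0) -> uniq r ->
  rnorm (\sum_(i <- r) v i) ^+ 2 = \sum_(i <- r) rnorm (v i) ^+ 2.
Proof.
move=> v_orth; elim: r => [_|i r IH /= /andP[ir /IH {}IH]].
  by rewrite !big_nil rnorm0 expr0n.
rewrite !big_cons rnormD_sqr IH ip_sumr big_seq big1 ?mulr0 ?addr0// => j jr.
by rewrite v_orth//; apply: contraNneq ir => ->.
Qed.

(** Norms at most 1, rather than equal to 1, admit the zero vectors that Gram-Schmidt produces from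
    dependent families. *)
Lemma bessel (u : I -> X) (r : seq I) x :
  (forall i j, i != j -> ip (u i) (u j) = 0) -> (forall i, rnorm (u i) <= 1) ->
  uniq r -> \sum_(i <- r) cmod (ip x (u i)) ^+ 2 <= rnorm x ^+ 2.
Proof.
move=> u_orth u1 r_uniq.
have := sqr_ge0 (rnorm (x + (- \sum_(i <- r) ip x (u i) *: u i))).
rewrite rnormD_sqr ipNr ReN rnormN pythagoras//; last first.
  by move=> i j ij; rewrite ipZl ipZr u_orth// !mulr0.
rewrite ip_sumr Re_sum.
rewrite [X in 2 * - X](eq_bigr (fun i => cmod (ip x (u i)) ^+ 2)); last first.
  by move=> i _; rewrite ipZr mulrC mulcJ.
have : \sum_(i <- r) rnorm (ip x (u i) *: u i) ^+ 2 <=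
       \sum_(i <- r) cmod (ip x (u i)) ^+ 2.
  apply: ler_sum => i _; rewrite rnormZ exprMn ler_piMr ?sqr_ge0//.
  by rewrite exprn_ile1 ?rnorm_ge0.
move: (\sum_(i <- r) _) (\sum_(i <- r) _) => a b; lra.
Qed.

Variable u : I -> X.
Hypothesis u_basis : orthonormal_basis u.

Lemma onb_orth i j : i != j -> ip (u i) (u j) = 0.
Proof. by move=> ij; rewrite u_basis.1 (negbTE ij). Qed.

Lemma onb_rnorm i : rnorm (u i) = 1.
Proof.
apply/eqP; rewrite -(@eqrXn2 _ 2) ?rnorm_ge0// expr1n; apply/eqP/complexI.
by rewrite -ipxx u_basis.1 eqxx.
Qed.

Lemma onb_bessel (r : seq I) x : uniq r ->
  \sum_(i <- r) cmod (ip x (u i)) ^+ 2 <= rnorm x ^+ 2.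
Proof.
by apply: bessel => [|i]; [exact: onb_orth|rewrite onb_rnorm].
Qed.

Lemma partial_sumE (V : zmodType) (x : I -> V) (J : {fset I}) :
  summability.partial_sum x J = \sum_(i <- J) x i.
Proof. by rewrite /summability.partial_sum big_seq_fsetE. Qed.

Lemma near_totally (i : I) : \forall J \near summability.totally, i \in (J : {fset I}).
Proof.
by exists [fset i]%fset => // J /= /fsubsetP; apply; rewrite inE.
Qed.

Lemma onb_eq_on (K : normedModType R[i]) (f g : X -> K) (C D : R) :
  linear f -> linear g -> 0 <= C -> 0 <= D -> rbounded C f -> rbounded D g ->
  (forall i, f (u i) = g (u i)) -> f =1 g.
Proof.
move=> fl gl C0 D0 fC gD fg; apply: (eq_on_cspan u_basis.2 fl gl C0 D0) => //.
by move=> _ [i _ <-].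
Qed.

(** The truncations [P J] are uniformly bounded by the hypothesis and Bessel's inequality, and on
    each [u i] they are eventually constant. *)
Lemma onb_extension (K : hilbertType R) (t : I -> K) (C : R) : 0 <= C ->
  (forall (r : seq I) (c : I -> R[i]), uniq r ->
    rnorm (\sum_(i <- r) c i *: t i) ^+ 2 <= C ^+ 2 * \sum_(i <- r) cmod (c i) ^+ 2) ->
  exists L : X -> K, [/\ linear L, rbounded C L, forall i, L (u i) = t i &
    forall x, norm_sum (fun i => ip x (u i) *: t i) (L x)].
Proof.
move=> C0 tC; pose P (J : {fset I}) (x : X) := \sum_(i <- J) ip x (u i) *: t i.
have Pl J : linear (P J).
  move=> a x y; rewrite /P scaler_sumr -big_split /=; apply: eq_bigr => i _.
  by rewrite ip_linearl scalerDl scalerA.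
have PC J : rbounded C (P J).
  move=> x; rewrite -(@ler_pXn2r _ 2) ?nnegrE ?mulr_ge0 ?rnorm_ge0//.
  rewrite (le_trans (tC _ _ (fset_uniq _)))// exprMn ler_wpM2l ?sqr_ge0//.
  exact/onb_bessel/fset_uniq.
have Pu i : \forall J \near summability.totally, P J (u i) = t i.
  apply: filterS (near_totally i) => J iJ.
  rewrite /P (bigD1_seq i) ?fset_uniq//= u_basis.1 eqxx scale1r.
  by rewrite big1 ?addr0// => j ji; rewrite onb_orth ?scale0r// eq_sym.
have Pui i : P^~ (u i) @ summability.totally --> t i by exact: cvg_near_cst.
have Pcvg s : range u s -> cvg (P^~ s @ summability.totally).
  by move=> [i _ <-]; apply/cvg_ex; exists (t i).
have [L [Ll LC PL]] := cvg_net _ Pl C0 PC u_basis.2 Pcvg.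
exists L; split => //.
  by move=> i; apply: cvg_unique (PL (u i)) (Pui i); exact: norm_hausdorff.
move=> x; rewrite /norm_sum (_ : summability.partial_sum _ = P^~ x)//.
by apply/funext => J; rewrite partial_sumE.
Qed.

(** The extension of [u i |-> u i] is the identity, since the two agree on the basis; its series is
    the expansion. *)
Lemma onb_expansion x : norm_sum (fun i => ip x (u i) *: u i) x.
Proof.
have h (r : seq I) (c : I -> R[i]) : uniq r ->
    rnorm (\sum_(i <- r) c i *: u i) ^+ 2 <= 1 ^+ 2 * \sum_(i <- r) cmod (c i) ^+ 2.
  move=> r_uniq; rewrite pythagoras//; last first.
    by move=> i j ij; rewrite ipZl ipZr onb_orth// !mulr0.
  rewrite expr1n mul1r; apply: ler_sum => i _.
  by rewrite rnormZ onb_rnorm mulr1.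
have [L [Ll LC Lu Lx]] := onb_extension ler01 h.
suff {2}<- : L x = x by [].
apply: (@onb_eq_on X L id 1 1) => // y; by rewrite mul1r.
Qed.

End Orthogonal.

(** * Compressions and words *)

Section Projection.
Variables (R : realType) (X : hilbertType R) (S : set X).

Lemma ip_cspan (x y : cspan_type S) : ip x y = ip (val x) (val y).
Proof. by []. Qed.

Lemma rnorm_cspan (x : cspan_type S) : rnorm x = rnorm (val x).
Proof. by []. Qed.

(** [cspan S] is a Hilbert space, so Riesz applied there to [z |-> <z, x>] yields the projection of
    [x]. *)
Lemma ip_proj (x : X) (z : cspan_type S) : ip (Defs.proj S x) z = ip x (val z).
Proof.
have [y xy] : exists y, forall z : cspan_type S, ip (val z) x = ip z y.
  apply: (@riesz _ _ (fun z : cspan_type S => ip (val z) x) (rnorm x)).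
    by move=> a v w; rewrite linearP ip_linearl.
  by move=> v; rewrite (le_trans (cauchy_schwarz _ _))// mulrC.
have : exists y, [set y : cspan_type S |
    forall z : cspan_type S, ip (x - val y) (val z) = 0] y.
  exists y => w; rewrite ipBl [ip x _]ip_conj xy -ip_conj ip_cspan subrr //.
move=> /(xgetPex 0)/(_ z); rewrite -/(Defs.proj S x) ipBl => /eqP.
by rewrite subr_eq0 => /eqP->.
Qed.

Lemma proj_linear : linear (Defs.proj S).
Proof.
move=> a x y; apply: ip_injl => z.
by rewrite ip_linearl !ip_proj ip_linearl.
Qed.

Lemma proj_bounded : rbounded 1 (Defs.proj S).
Proof.
move=> x; rewrite mul1r; have [->|Px0] := eqVneq (Defs.proj S x) 0.
  by rewrite rnorm0 rnorm_ge0.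
have Px : 0 < rnorm (Defs.proj S x) by rewrite lt_def rnorm_eq0 Px0 rnorm_ge0.
rewrite -(ler_pM2r Px) -expr2.
have -> : rnorm (Defs.proj S x) ^+ 2 = complex.Re (ip x (val (Defs.proj S x))).
  by rewrite -ip_proj ipxx.
by rewrite (le_trans (Re_le_cmod _))// (le_trans (cauchy_schwarz _ _)).
Qed.

Lemma compressionE (W : 'B(X)) (x : cspan_type S) :
  compression S W x = Defs.proj S (W (val x)).
Proof.
suff : exists B, [set B : 'B(cspan_type S) | forall x, B x = Defs.proj S (W (val x))] B.
  by move=> /(xgetPex 0); apply.
have [C C0 WC] := bop_bounded W.
have fl : linear (fun x : cspan_type S => Defs.proj S (W (val x))).
  move=> a v w; cbv beta.
  by rewrite (_ : val (a *: v + w) = a *: val v + val w) ?linearP// proj_linear.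
have fC : rbounded C (fun x : cspan_type S => Defs.proj S (W (val x))).
  by move=> v; rewrite (le_trans (proj_bounded _))// mul1r.
by have [B BW] := bop_exists fl fC; exists B.
Qed.

(* The span is computed in the subspace itself, not in the ambient space. *)
Lemma cspan_in_cspan (I : Type) (y : I -> cspan_type S) :
  S `<=` range (fun i => val (y i)) -> cspan (range y) = setT.
Proof.
move=> Sy; apply/seteqP; split => // -[x xS] _ M [[Mc M0 ML] yM].
have xS' : cspan S x by exact/asboolP.
suff [v Mv vx] : [set x | exists2 v, M v & val v = x] x.
  by rewrite (_ : CSpan xS = v)//; apply: val_inj.
apply: xS'; split; first split.
- apply: closed_rnorm => z zM; have zS : cspan S z.
      have [Sc _ _] := cspan_closed_submod S.
      apply: (closedP_rnorm Sc) => e /zM[w [v _ <-] zw].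
      by exists (val v) => //; exact/asboolP/(valP v).
    pose z' := CSpan (introT (asboolP _) zS : z \in cspan_pred S).
    exists z' => //; apply: (closedP_rnorm Mc) => e /zM[w [v Mv <-] zw].
    by exists v.
- by exists 0.
- by move=> a _ _ [v Mv <-] [w Mw <-]; exists (a *: v + w); [exact: ML|rewrite linearP].
- by move=> z /Sy[i _ <-]; exists (y i) => //; apply: yM; exists i.
Qed.

End Projection.

Lemma onb_ip_inj (R : realType) (X : hilbertType R) (I : choiceType) (u : I -> X)
    (x y : X) : orthonormal_basis u -> (forall i, ip x (u i) = ip y (u i)) -> x = y.
Proof.
move=> uB xy; have xE := @onb_expansion _ _ _ _ uB x.
have yE := @onb_expansion _ _ _ _ uB y.
have E : (fun i => ip x (u i) *: u i) = (fun i => ip y (u i) *: u i).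
  by apply/funext => i; rewrite xy.
rewrite E in xE; exact: (cvg_unique (@norm_hausdorff _ X) xE yE).
Qed.

Section WordType.
Variable n : nat.
Implicit Types (a b : word n) (k : mindex n) (i j : 'I_n).

(** The abelianization of a word: [Lambda k] is its fibre over [k]. *)
Definition wtype a : mindex n := [ffun i => count_mem i a].

Definition incr k i : mindex n := [ffun j => (k j + (j == i))%N].

Lemma wtype_cons i a : wtype (i :: a) = incr (wtype a) i.
Proof. by apply/ffunP => j; rewrite !ffunE /= addnC eq_sym. Qed.

Section Commuting.
Variables (A : pzRingType) (T : 'I_n -> A).
Hypothesis TC : forall i j, T i * T j = T j * T i.

Lemma monom_incr k i : monom T (incr k i) = T i * monom T k.
Proof.
rewrite /monom.
have h (r : seq 'I_n) : uniq r -> \prod_(j <- r) T j ^+ incr k i j =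
    (if i \in r then T i else 1) * \prod_(j <- r) T j ^+ k j.
  elim: r => [_|j r IH /= /andP[jr ru]]; first by rewrite !big_nil mulr1.
  rewrite !big_cons inE (IH ru) !ffunE; have [ij|ij] := eqVneq i j.
    by rewrite -ij in jr *; rewrite (negbTE jr) addn1 mul1r exprS mulrA.
  rewrite addn0 mulrA mulrA; congr (_ * _).
  case: ifP => _; last by rewrite mul1r mulr1.
  by apply/esym/commrX/TC.
by rewrite h ?index_enum_uniq// mem_index_enum.
Qed.

Lemma monom0 : monom T [ffun=> 0%N] = 1.
Proof. by rewrite /monom big1// => i _; rewrite ffunE. Qed.

Lemma wordpowE a : wordpow T a = monom T (wtype a).
Proof.
elim: a => [|i a IH].
  have -> : wtype [::] = [ffun=> 0%N] by apply/ffunP => j; rewrite !ffunE.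
  by rewrite monom0 /wordpow big_nil.
by rewrite wtype_cons monom_incr -IH /wordpow big_cons.
Qed.

End Commuting.

(** Makes every [Lambda k] nonempty, hence [omega k] positive, and lets statements on multi-indices
    be proved by induction on words. *)
Lemma wtype_onto k : exists a, wtype a = k.
Proof.
exists (flatten [seq nseq (k i) i | i <- enum 'I_n]); apply/ffunP => j.
rewrite ffunE count_flatten sumnE big_map big_map big_enum /=.
rewrite (bigD1 j)//= big1 => [|i ij]; first by rewrite count_nseq /= eqxx mul1n addn0.
by rewrite count_nseq /= (negbTE ij).
Qed.

Lemma deg_wtype a : deg (wtype a) = size a.
Proof.
elim: a => [|i a IH]; first by rewrite /deg big1// => j _; rewrite ffunE.
rewrite wtype_cons /= -IH /deg -addn1.
under eq_bigr do rewrite ffunE.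
rewrite big_split /=; congr (_ + _)%N.
by rewrite (bigD1 i)//= eqxx big1 ?addn0// => j /negbTE->.
Qed.

Lemma finite_words m : finite_set [set a : word n | (size a <= m)%N].
Proof.
pose f (t : {i : 'I_m.+1 & i.-tuple 'I_n}) : word n := tval (tagged t).
apply: (@sub_finite_set _ _ (f @` setT)); last exact/finite_image/finite_finset.
move=> a /= am; have am' : (size a < m.+1)%N by rewrite ltnS.
by exists (existT _ (Ordinal am') (in_tuple a)).
Qed.

Lemma finite_mindex N : finite_set [set k : mindex n | (deg k <= N)%N].
Proof.
apply: (@sub_finite_set _ _ (wtype @` [set a | (size a <= N)%N])).
  by move=> k /= kN; have [a ak] := wtype_onto k; exists a; rewrite //= -deg_wtype ak.
exact/finite_image/finite_words.
Qed.

End WordType.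

(** * The symmetric weighted Fock space *)

Section Symmetric.
Variables (R : realType) (n : nat) (mu : word n -> R).
Hypothesis mu_adm : admissible_weights mu.
Implicit Types (a b : word n) (k : mindex n) (i j : 'I_n).

Lemma LambdaE k : Lambda (R := R) k = [set a | wtype a = k].
Proof.
have pow (l : 'I_n -> R[i]) a : wordpow l a = monom l (wtype a).
  by apply: wordpowE => i j; rewrite mulrC.
apply/seteqP; split => a /=; last by move=> <- l; exact: pow.
move=> ak; apply/ffunP => i.
(* Evaluating at 2 in coordinate [i] and 1 elsewhere reads off the exponent of [i]. *)
pose l j : R[i] := if j == i then 2 else 1.
have lk (k' : mindex n) : monom l k' = 2 ^+ k' i.
  rewrite /monom (bigD1 i)//= /l eqxx big1 ?mulr1// => j /negbTE->.
  by rewrite expr1n.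
have := ak l; rewrite pow !lk => /eqP.
by rewrite -!natrX eqr_nat eqn_exp2l// => /eqP.
Qed.

Lemma finite_Lambda k : finite_set (Lambda (R := R) k).
Proof.
rewrite LambdaE; apply: (@sub_finite_set _ _ _ _ (finite_words n (deg k))).
by move=> a /= <-; rewrite deg_wtype.
Qed.

Definition Lam k : {fset word n} := fset_set (Lambda (R := R) k).

Lemma in_Lam k a : (a \in Lam k) = (wtype a == k).
Proof.
rewrite in_fset_set; last exact: finite_Lambda.
by rewrite LambdaE; apply/idP/eqP; rewrite inE.
Qed.

Lemma bmu_gt0 a : 0 < bmu mu a.
Proof.
have [mu0 _ _ _] := mu_adm; elim: a => [|i a IH]; first exact: ltr01.
by rewrite /= mulr_gt0.
Qed.

Lemma omegaE k : omega mu k = \sum_(a <- Lam k) bmu mu a ^- 2.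
Proof. by rewrite /omega fsbig_finite//; exact: finite_Lambda. Qed.

Lemma omega_gt0 k : 0 < omega mu k.
Proof.
have [a ak] := wtype_onto k.
rewrite omegaE (bigD1_seq a) ?fset_uniq ?in_Lam ?ak//=.
rewrite ltr_pwDl ?invr_gt0 ?exprn_gt0 ?bmu_gt0//.
by apply: sumr_ge0 => b _; rewrite invr_ge0 exprn_ge0// ltW// bmu_gt0.
Qed.

Section Fock.
Variables (F : hilbertType R) (e : word n -> F).
Hypothesis e_basis : orthonormal_basis e.

(** Prepending [i] is injective, so the prescribed images are orthogonal, with norms at most
    [M = sup_b mu (i :: b)]; hence a bounded extension exists. *)
Lemma shiftE i a : Defs.shift mu e i (e a) = (mu (i :: a))%:C *: e (i :: a).
Proof.
suff : exists W, [set W : 'B(F) | forall a, W (e a) = (mu (i :: a))%:C *: e (i :: a)] W.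
  by move=> /(xgetPex 0); apply.
have [mu0 /(_ i)[M Mmu] _ _] := mu_adm.
have {}Mmu b : `|mu (i :: b)| <= M by rewrite gtr0_norm// Mmu//; exists b.
have M0 : 0 <= M by exact: le_trans (Mmu [::]).
have muM (r : seq (word n)) (c : word n -> R[i]) : uniq r ->
    rnorm (\sum_(b <- r) c b *: ((mu (i :: b))%:C *: e (i :: b))) ^+ 2 <=
    M ^+ 2 * \sum_(b <- r) cmod (c b) ^+ 2.
  move=> r_uniq; rewrite pythagoras//; last first.
    move=> b b' bb'; rewrite !ipZl !ipZr (onb_orth e_basis) ?mulr0//.
    by rewrite eqseq_cons eqxx.
  rewrite mulr_sumr; apply: ler_sum => b _.
  rewrite !rnormZ (onb_rnorm e_basis) mulr1 exprMn mulrC.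
  rewrite ler_wpM2r ?sqr_ge0// cmod_real.
  by rewrite ler_pXn2r ?nnegrE.
have [L [Ll LM Le _]] := onb_extension e_basis M0 muM.
by have [W WL] := bop_exists Ll LM; exists W => b; rewrite WL.
Qed.

Lemma yvecE k :
  yvec mu e k = (omega mu k)^-1%:C *: \sum_(a <- Lam k) (bmu mu a)^-1%:C *: e a.
Proof. by rewrite /yvec fsbig_finite//; exact: finite_Lambda. Qed.

Lemma ip_yvec (x : F) k :
  ip x (yvec mu e k) =
    (omega mu k)^-1%:C * \sum_(a <- Lam k) (bmu mu a)^-1%:C * ip x (e a).
Proof.
rewrite yvecE ipZr conjC_real ip_sumr; congr (_ * _).
by apply: eq_bigr => a _; rewrite ipZr conjC_real.
Qed.

Lemma ip_e_yvec a k :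
  ip (e a) (yvec mu e k) =
    (if wtype a == k then (omega mu k)^-1 * (bmu mu a)^-1 else 0)%:C.
Proof.
rewrite ip_yvec; case: ifPn => ak.
  rewrite (bigD1_seq a) ?fset_uniq ?in_Lam//= big1 ?addr0.
    by rewrite e_basis.1 eqxx mulr1 rmorphM.
  by move=> b ba; rewrite (onb_orth e_basis) ?mulr0// eq_sym.
rewrite big_seq big1 ?mulr0// => b; rewrite in_Lam => /eqP bk.
rewrite (onb_orth e_basis) ?mulr0//; apply: contraNneq ak => ->.
by rewrite bk.
Qed.

(** Different multi-indices involve disjoint sets of words; on the diagonal the value is
    [omega_k^-2 \sum_a bmu(a)^-2]. *)
Lemma ip_yvec_yvec (j k : mindex n) :
  ip (yvec mu e j) (yvec mu e k) = (if j == k then (omega mu k)^-1 else 0)%:C.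
Proof.
rewrite yvecE ipZl ip_suml.
under eq_big_seq => a.
  rewrite in_Lam => /eqP aj; rewrite ipZl ip_e_yvec aj -rmorphM /=.
  over.
rewrite -rmorph_sum -rmorphM; congr (_%:C); have [->|jk] := eqVneq j k; last first.
  by rewrite big1 ?mulr0// => a _; rewrite mulr0.
under eq_bigr do rewrite mulrCA -expr2 exprVn.
by rewrite -mulr_sumr -omegaE mulVf ?mulr1// gt_eqF// omega_gt0.
Qed.

Local Notation Y := (ys mu e).
Local Notation FsT := (Fs mu e).

Lemma ip_ys (j k : mindex n) :
  ip (Y j) (Y k) = (if j == k then (omega mu k)^-1 else 0)%:C.
Proof. exact: ip_yvec_yvec. Qed.

Definition us k : FsT := (Num.sqrt (omega mu k))%:C *: Y k.

Lemma ys_us k : Y k = (Num.sqrt (omega mu k))^-1%:C *: us k.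
Proof.
rewrite /us scalerA -rmorphM mulVf ?scale1r//.
by rewrite gt_eqF// sqrtr_gt0 omega_gt0.
Qed.

Lemma cspan_ys : cspan (range Y) = setT.
Proof. by apply: cspan_in_cspan => _ [k _ <-]; exists k. Qed.

Lemma us_basis : orthonormal_basis us.
Proof.
split=> [j k|].
  rewrite ipZl ipZr conjC_real ip_ys -!rmorphM /=.
  have [->|jk] := eqVneq j k; last by rewrite !mulr0.
  rewrite mulrA -expr2 sqr_sqrtr ?(ltW (omega_gt0 k))// mulfV//.
  by rewrite gt_eqF// omega_gt0.
apply/seteqP; split => // x _ M [[Mc M0 ML] uM].
apply: (@cspan_ind R _ _ M cspan_ys) => // _ [k _ <-].
by rewrite ys_us -[_ *: _]addr0; apply: ML => //; apply: uM; exists k.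
Qed.

(** The weight [mu (i :: a)] from the shift cancels the extra factor of [bmu (i :: a)] in
    [y^(k + e_i)], so the coefficients sum to [omega_k^-1 \sum_a bmu(a)^-2 = 1] times
    [omega_j^-1]. *)
Lemma Bop_ys i k : Bop_s mu e i (Y k) = Y (incr k i).
Proof.
apply: (onb_ip_inj us_basis) => j; rewrite !ipZr; congr (_ * _).
rewrite ip_ys /Bop_s compressionE ip_proj /= yvecE linearZ /= ipZl linear_sum.
rewrite ip_suml.
under eq_big_seq => a.
  rewrite in_Lam => /eqP ak; rewrite linearZ /= shiftE !ipZl ip_e_yvec.
  rewrite wtype_cons ak -!rmorphM /=.
  over.
rewrite -rmorph_sum -rmorphM; congr (_%:C).
have [_|_] := eqVneq (incr k i) j; last first.
  by rewrite big1 ?mulr0// => a _; rewrite !mulr0.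
have mu0 a : mu (i :: a) != 0 by have [mu0 _ _ _] := mu_adm; rewrite gt_eqF.
rewrite (eq_bigr (fun a => (omega mu j)^-1 * bmu mu a ^- 2)).
  by rewrite -mulr_sumr -omegaE mulrCA mulVf ?mulr1// gt_eqF// omega_gt0.
move=> a _; have bmu0 : bmu mu a != 0 by rewrite gt_eqF// bmu_gt0.
have om0 : omega mu j != 0 by rewrite gt_eqF// omega_gt0.
by field; rewrite mu0 om0 bmu0.
Qed.

Lemma vacuumE : vacuum mu e = Y [ffun=> 0%N].
Proof. by apply: val_inj; rewrite /= yvec0. Qed.

Lemma Bop_comm i j : Bop_s mu e i * Bop_s mu e j = Bop_s mu e j * Bop_s mu e i.
Proof.
apply: bop_ext => x.
have [C C0 hC] := bop_bounded (Bop_s mu e i * Bop_s mu e j).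
have [D D0 hD] := bop_bounded (Bop_s mu e j * Bop_s mu e i).
apply: (eq_on_cspan cspan_ys (bop_linear _) (bop_linear _) C0 D0 hC hD).
move=> _ [k _ <-]; rewrite !bopME !Bop_ys; congr (ys _ _ _).
by apply/ffunP => l; rewrite !ffunE addnAC.
Qed.

Lemma monom_Bop_vacuum k : monom (Bop_s mu e) k (vacuum mu e) = Y k.
Proof.
have [a <-] := wtype_onto k; rewrite -(wordpowE Bop_comm).
elim: a => [|i a IH].
  have -> : wtype [::] = [ffun=> 0%N] :> mindex n by apply/ffunP => j; rewrite !ffunE.
  by rewrite /wordpow big_nil bop1E vacuumE.
by rewrite /wordpow big_cons bopME IH Bop_ys wtype_cons.
Qed.

(** Fourier coefficients are forced: the [y^(k)] are orthogonal and [|y^(k)|^2 = omega_k^-1], whence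
    the factor [omega_k]. *)
Lemma fourier_coef A c : fourier (mu := mu) (e := e) A c ->
  forall k, c k = (omega mu k)%:C * ip (A (vacuum mu e)) (Y k).
Proof.
move=> /cvg_ipl Ac k; have {}Ac := Ac (Y k).
have cE : (fun J => ip (summability.partial_sum (fun k => c k *: Y k) J) (Y k) : R[i]^o)
     @ summability.totally --> (c k * (omega mu k)^-1%:C : R[i]^o).
  apply: cvg_near_cst; apply: filterS (near_totally k) => J kJ.
  rewrite partial_sumE ip_suml (bigD1_seq k) ?fset_uniq//= big1.
    by rewrite addr0 ipZl ip_ys eqxx.
  by move=> j jk; rewrite ipZl ip_ys (negbTE jk) mulr0.
rewrite (cvg_unique (@norm_hausdorff _ _) Ac cE) mulrCA -rmorphM mulfV ?mulr1//.
by rewrite gt_eqF// omega_gt0.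
Qed.

Lemma fourier_exists A :
  fourier (mu := mu) (e := e) A
    (fun k => (omega mu k)%:C * ip (A (vacuum mu e)) (Y k)).
Proof.
rewrite /fourier.
have -> : (fun k => ((omega mu k)%:C * ip (A (vacuum mu e)) (Y k)) *: Y k) =
    (fun k => ip (A (vacuum mu e)) (us k) *: us k).
  apply/funext => k; rewrite /us ipZr conjC_real scalerA mulrAC -rmorphM.
  by rewrite -expr2 sqr_sqrtr// ltW// omega_gt0.
exact: (onb_expansion us_basis).
Qed.

End Fock.
End Symmetric.

(** * Operator topologies *)

Section PointwiseTopologies.

Lemma cvg_initial (S : choiceType) (T : topologicalType) (f : S -> T)
    (F : set_system S) (s : S) : Filter F ->
  f @ F --> f s <-> F --> (s : initial_topology f).
Proof.
move=> FF; split=> [fF A /= [_ [[B Bop <-] Bfs sBfA]]|Fs].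
  have /fF FB : nbhs (f s) B by apply: open_nbhs_nbhs.
  by rewrite nbhs_filterE; apply: filterS sBfA _.
by apply: cvg_comp Fs _; exact: initial_continuous.
Qed.

Lemma cvg_ptws (I : Type) (V : topologicalType) (F : set_system (I -> V))
    (g : I -> V) : Filter F ->
  F --> (g : {ptws I -> V}) <-> forall i, (fun h => h i) @ F --> g i.
Proof.
move=> FF; rewrite (@cvg_sup {ptws I -> V} I); split => Fg i.
  by have /cvg_initial := Fg i.
by apply/cvg_initial; exact: Fg.
Qed.

(** The three operator topologies are all induced by maps into a space of functions with pointwise
    convergence, so this serves for each. *)
Lemma cvg_initial_ptws (S : choiceType) (I : Type) (V : topologicalType)
    (phi : S -> I -> V) (U : Type) (F : set_system U) (A : U -> S) (B : S) :
  Filter F ->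
  A @ F --> (B : initial_topology (phi : S -> {ptws I -> V})) <->
  forall i, (fun u => phi (A u) i) @ F --> phi B i.
Proof. by move=> FF; rewrite -cvg_initial cvg_ptws. Qed.

End PointwiseTopologies.

Section OperatorTopologies.
Variables (R : realType) (H : hilbertType R).
Variables (U : Type) (F : set_system U) (FF : Filter F).
Implicit Types (A : U -> 'B(H)) (B : 'B(H)).

Lemma cvg_sotP A B :
  A @ F --> (B : sot H) <-> forall x, (fun u => A u x) @ F --> B x.
Proof. exact: (@cvg_initial_ptws _ _ _ (@bop_fun R H)). Qed.

Lemma cvg_wotP A B :
  A @ F --> (B : wot H) <->
  forall x y, (fun u => ip (A u x) y : R[i]^o) @ F --> (ip (B x) y : R[i]^o).
Proof.
rewrite (@cvg_initial_ptws _ _ _ (fun (A : 'B(H)) (xy : H * H) =>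
  (ip (A xy.1) xy.2 : R[i]^o))).
by split => h => [x y|[x y]]; [exact: (h (x, y))|exact: h].
Qed.

End OperatorTopologies.

(** * Functionals of the w*-topology *)

Section WeakStar.
Variable R : realType.

Lemma l2_bounded (H : hilbertType R) (x : l2 H) :
  exists L : R, forall N, \sum_(0 <= j < N) rnorm (sval x j) ^+ 2 <= L.
Proof.
case: x => x /= x_lty.
have x_ge N : ((\sum_(0 <= j < N) rnorm (x j) ^+ 2)%:E <=
    \sum_(0 <= j <oo) (rnorm (x j) ^+ 2)%:E)%E.
  rewrite -sumEFin; apply: nneseries_lim_ge => j _ _.
  by rewrite lee_fin sqr_ge0.
exists (fine (\sum_(0 <= j <oo) (rnorm (x j) ^+ 2)%:E)%E) => N.
by rewrite -lee_fin fineK// fin_numElt x_lty (lt_le_trans _ (x_ge N))// ltNyr.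
Qed.

(** The sequence [x, 0, 0, ...], for which the trace class functional reduces to the rank one
    functional [A |-> <A x, y>]. *)
Definition single (H : hilbertType R) (x : H) (j : nat) : H :=
  if j == 0%N then x else 0.

Lemma single_l2 (H : hilbertType R) (x : H) :
  (\sum_(0 <= j <oo) (rnorm (single x j) ^+ 2)%:E < +oo)%E.
Proof.
rewrite (@cvg_lim _ _ _ _ _ _ (rnorm x ^+ 2)%:E) ?ltry//.
apply: cvg_near_cst; exists 1%N => // N /= N1.
rewrite (big_ltn N1) big_nat_cond big1 ?adde0// => j /andP[/andP[j1 _] _].
by rewrite /single gtn_eqF// rnorm0 expr0n.
Qed.

Definition single_seq (H : hilbertType R) (x : H) : l2 H :=
  exist _ (single x) (single_l2 x).

Lemma wstar_single (H : hilbertType R) (A : 'B(H)) (x y : H) :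
  limn (series (fun j => ip (A (single x j)) (single y j) : R[i]^o)) = ip (A x) y.
Proof.
apply: cvg_lim; first exact: norm_hausdorff.
apply: cvg_near_cst; exists 1%N => // N /= N1.
rewrite /series /= (big_ltn N1) big_nat_cond big1 ?addr0// => j /andP[/andP[j1 _] _].
by rewrite /single gtn_eqF// ip0r.
Qed.

Lemma cvg_wstar_ip (H : hilbertType R) (U : Type) (F : set_system U) (FF : Filter F)
    (A : U -> 'B(H)) (B : 'B(H)) x y :
  A @ F --> (B : wstar H) ->
  (fun u => ip (A u x) y : R[i]^o) @ F --> (ip (B x) y : R[i]^o).
Proof.
move=> /cvg_initial_ptws/(_ (single_seq x, single_seq y)) /=.
rewrite wstar_single.
by under eq_cvg do rewrite wstar_single.
Qed.

Lemma cvg_series_summable (X : hilbertType R) (w : nat -> X) (b : nat -> R)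
    (L : R) : (forall j, rnorm (w j) <= b j) ->
  (forall N, \sum_(0 <= j < N) b j <= L) -> cvgn (series w).
Proof.
move=> wb bL; pose s N := \sum_(0 <= j < N) b j.
have s_sup : has_sup (range s).
  by split; [exists (s 0%N), 0%N|exists L => _ [N _ <-]; exact: bL].
apply: cauchy_rnorm => eps eps0.
have [_ [N _ <-] sN] := sup_adherent eps0 s_sup.
exists (series w N); exists N => // M /= NM.
rewrite rnorm_distC /series /= (big_cat_nat (leq0n N) NM)//= addrAC subrr add0r.
rewrite (le_lt_trans (rnorm_sum _ _))//.
apply: (@le_lt_trans _ _ (s M - s N)).
  rewrite /s (big_cat_nat (leq0n N) NM)//= addrAC subrr add0r.
  by apply: ler_sum => j _; exact: wb.
have sM : s M <= sup (range s) by apply: sup_upper_bound => //; exists M.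
by rewrite ltrBlDr (le_lt_trans sM)// addrC -ltrBlDr.
Qed.

(* The functional [v |-> \sum_j <Phi v x_j, y_j>] is represented by
   [w = \sum_j w_j], where [w_j] represents [v |-> <Phi v x_j, y_j>]. *)
Lemma wstar_functional (X H : hilbertType R) (Phi : X -> 'B(H)) (C : R)
    (x y : l2 H) : 0 <= C ->
  (forall h, linear (fun v => Phi v h)) ->
  (forall v h, rnorm (Phi v h) <= C * rnorm h * rnorm v) ->
  exists w : X, forall v,
    limn (series (fun j => ip (Phi v (sval x j)) (sval y j) : R[i]^o)) = ip v w.
Proof.
move=> C0 Philin PhiC.
have riesz_j j : exists w, forall v, ip (Phi v (sval x j)) (sval y j) = ip v w.
  apply: (@riesz _ _ (fun v => ip (Phi v (sval x j)) (sval y j))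
    (C * rnorm (sval x j) * rnorm (sval y j))) => [a u v|v].
    by rewrite Philin ip_linearl.
  rewrite (le_trans (cauchy_schwarz _ _))// mulrAC.
  by rewrite ler_wpM2r ?rnorm_ge0.
have [w xyw] := choice riesz_j.
(* [|x_j| |y_j| <= |x_j|^2 + |y_j|^2] turns square summability into a summable majorant of
   [|w_j|]. *)
pose b j := (rnorm (sval x j) ^+ 2 + rnorm (sval y j) ^+ 2).
have wb j : rnorm (w j) <= C * b j.
  have [->|wj0] := eqVneq (w j) 0.
    by rewrite rnorm0 mulr_ge0// addr_ge0 ?sqr_ge0.
  have wj : 0 < rnorm (w j) by rewrite lt_def rnorm_eq0 wj0 rnorm_ge0.
  rewrite -(ler_pM2r wj) -expr2.
  have -> : rnorm (w j) ^+ 2 = complex.Re (ip (w j) (w j)) by rewrite ipxx.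
  rewrite -xyw (le_trans (Re_le_cmod _))// (le_trans (cauchy_schwarz _ _))//.
  apply: (le_trans (ler_wpM2r (rnorm_ge0 _) (PhiC _ _))).
  rewrite -!mulrA ler_wpM2l// mulrA mulrAC ler_wpM2r ?rnorm_ge0//.
  rewrite /b; set s := rnorm _; set t := rnorm _.
  have := sqr_ge0 (s - t); have := sqr_ge0 s; have := sqr_ge0 t.
  by nra.
have [L bL] : exists L, forall N, \sum_(0 <= j < N) C * b j <= L.
  have [Lx xL] := l2_bounded x; have [Ly yL] := l2_bounded y.
  exists (C * (Lx + Ly)) => N.
  by rewrite -mulr_sumr ler_wpM2l// big_split lerD.
have /cvg_ex[w0 w0P] := cvg_series_summable wb bL.
exists w0 => v; apply: cvg_lim; first exact: norm_hausdorff.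
have vE N : series (fun j => ip (Phi v (sval x j)) (sval y j) : R[i]^o) N =
    ip v (series w N).
  by rewrite /series /= ip_sumr; apply: eq_bigr => j _; exact: xyw.
have /cvg_rnormP w0v := w0P; apply/cvg_rnormP => eps eps0.
have v1 : 0 < rnorm v + 1 by rewrite ltr_wpDl ?rnorm_ge0.
have := w0v _ (divr_gt0 eps0 v1); apply: filterS => N hN.
rewrite vE -ipBr (le_lt_trans (cauchy_schwarz _ _))//.
apply: (@le_lt_trans _ _ ((rnorm v + 1) * rnorm (w0 - series w N))).
  by rewrite ler_wpM2r ?rnorm_ge0// lerDl.
by rewrite mulrC -ltr_pdivlMr.
Qed.

End WeakStar.

(** * The Poisson kernel of a commuting tuple *)

Section PoissonKernel.
Variables (R : realType) (n : nat) (mu : word n -> R).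
Hypothesis mu_adm : admissible_weights mu.
Variables (H : hilbertType R) (T : 'I_n -> 'B(H)) (S : 'B(H)).
Hypotheses (TC : forall i j, T i * T j = T j * T i)
  (TS : wot_sum (fun a : word n =>
      (bmu mu a ^- 2)%:C *: (wordpow T a * adj (wordpow T a))) S).

(** The sum over a finite [K] of multi-indices equals the sum over the finite set [W K] of words
    with type in [K]. As [W] is cofinal, the new net of partial sums is a subnet of the given
    one. *)
Lemma wot_sum_monom :
  wot_sum (fun k : mindex n =>
    (omega mu k)%:C *: (monom T k * adj (monom T k))) S.
Proof.
pose W (K : {fset mindex n}) : {fset word n} :=
  [fset a in flatten [seq (Lam R k : seq (word n)) | k <- K]]%fset.
have inW K a : (a \in W K) = (wtype a \in K).
  rewrite inE; apply/flatten_mapP/idP => [[k kK]|aK].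
    by rewrite in_Lam => /eqP->.
  by exists (wtype a) => //; rewrite in_Lam.
have W_totally : W @ summability.totally --> summability.totally.
  move=> B [A _ AJ]; exists [fset wtype a | a in A]%fset => // K /= AK.
  apply: AJ; apply/fsubsetP => a aA; rewrite inW.
  by apply: (fsubsetP AK); apply/imfsetP; exists a.
have WE K : summability.partial_sum (fun k : mindex n =>
      (omega mu k)%:C *: (monom T k * adj (monom T k))) K =
    summability.partial_sum (fun a : word n =>
      (bmu mu a ^- 2)%:C *: (wordpow T a * adj (wordpow T a))) (W K).
  rewrite !partial_sumE (partition_big_imfset _ (@wtype n)).
  have -> : [fset wtype a | a in W K]%fset = K.
    apply/fsetP => k; apply/imfsetP/idP => [[a /= aW ->]|kK].
      by rewrite -inW.
    by have [a ak] := wtype_onto k; exists a; rewrite //= inW ak.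
  rewrite !big_seq; apply: eq_bigr => k kK.
  rewrite omegaE rmorph_sum scaler_suml -[RHS]big_filter.
  rewrite [RHS](perm_big (Lam R k)).
    rewrite !big_seq; apply: eq_bigr => a; rewrite in_Lam => /eqP ak.
    by rewrite (wordpowE TC) ak.
  apply: uniq_perm => [||a]; rewrite ?filter_uniq ?fset_uniq//.
  rewrite mem_filter in_Lam inW; have [->|//] := eqVneq (wtype a) k.
  by rewrite kK.
rewrite /wot_sum (_ : summability.partial_sum _ =
  summability.partial_sum (fun a : word n =>
      (bmu mu a ^- 2)%:C *: (wordpow T a * adj (wordpow T a))) \o W).
  exact: cvg_comp W_totally TS.
by apply/funext => K; rewrite WE.
Qed.

(** After pairing with [z] all terms are nonnegative, so a finite part is dominated by the limit
    [<S z, z>]. *)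
Lemma omega_adj_le (r : seq (mindex n)) (z : H) : uniq r ->
  \sum_(k <- r) omega mu k * rnorm (adj (monom T k) z) ^+ 2 <=
  opnorm S * rnorm z ^+ 2.
Proof.
move=> r_uniq; rewrite -subr_le0; apply: (@le0_eps _ _ 1) => // eps eps0.
rewrite mul1r lerBlDr.
have /cvg_wotP/(_ z z)/cvg_rnormP/(_ eps eps0) Sz := wot_sum_monom.
have rK : \forall K \near summability.totally, ([fset k in r] `<=` K)%fset.
  by exists [fset k in r]%fset.
have [K [{Sz}Sz {}rK]] := filter_ex (filterI Sz rK).
pose g k := omega mu k * rnorm (adj (monom T k) z) ^+ 2.
have g_ge0 k : 0 <= g k by rewrite mulr_ge0 ?sqr_ge0// ltW// omega_gt0.
have rKle : \sum_(k <- r) g k <= \sum_(k <- K) g k.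
  rewrite [leRHS](bigID (mem r)) /= -[leLHS]addr0 lerD ?sumr_ge0//.
  rewrite -[leRHS]big_filter [leRHS](perm_big r)//; apply: uniq_perm => //.
    by rewrite filter_uniq ?fset_uniq.
  move=> k; rewrite mem_filter; have [kr|//] := boolP (k \in r).
  by apply: (fsubsetP rK); rewrite inE.
have KE : complex.Re (ip (summability.partial_sum (fun k : mindex n =>
      (omega mu k)%:C *: (monom T k * adj (monom T k))) K z) z) =
    \sum_(k <- K) g k.
  rewrite partial_sumE bop_sumE ip_suml Re_sum; apply: eq_bigr => k _.
  by rewrite bopZE ipZl ReZ bopME adjP ipxx.
have Sz_le : complex.Re (ip (S z) z) <= opnorm S * rnorm z ^+ 2.
  rewrite (le_trans (Re_le_cmod _))// (le_trans (cauchy_schwarz _ _))//.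
  by rewrite expr2 mulrA ler_wpM2r ?rnorm_ge0// opnormP.
apply: (le_trans rKle); rewrite -KE -lerBlDl; apply: le_trans Sz_le.
rewrite lerBlDl -lerBlDr (le_trans _ (ltW Sz))//.
rewrite -ReN -ReD rnorm_distC; exact: Re_le_cmod.
Qed.

(* Row contractivity of [(sqrt (omega k) T^k)_k], by duality with the previous
   bound on its adjoint. *)
Lemma row_bound (r : seq (mindex n)) (h : mindex n -> H) : uniq r ->
  rnorm (\sum_(k <- r) monom T k (h k)) ^+ 2 <=
  opnorm S * \sum_(k <- r) (omega mu k)^-1 * rnorm (h k) ^+ 2.
Proof.
move=> r_uniq; set z := \sum_(k <- r) _; set D := opnorm S.
have D0 : 0 <= D := opnorm_ge0 S.
have zE : rnorm z ^+ 2 =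
    \sum_(k <- r) complex.Re (ip (h k) (adj (monom T k) z)).
  transitivity (complex.Re (ip z z)); first by rewrite ipxx.
  rewrite {1}/z ip_suml Re_sum.
  by apply: eq_bigr => k _; rewrite adjP.
have adjz := omega_adj_le z r_uniq.
(* The case [D = 0] is separate because the main estimate divides by [D]; here every [(T^k)^* z]
   vanishes. *)
move: D0; rewrite le_eqVlt => /predU1P[D0|D0].
  rewrite zE -D0 mul0r big_seq big1// => k kr.
  suff /eqP -> : adj (monom T k) z == 0 by rewrite ip0r.
  rewrite -rnorm_eq0 -sqrf_eq0 eq_le sqr_ge0 andbT.
  rewrite -(pmulr_rle0 _ (omega_gt0 mu_adm k)).
  have := @omega_adj_le [:: k] z isT.
  by rewrite big_seq1 -/D -D0 mul0r.
(* Weighted arithmetic-geometric mean inequality with weight [D / omega_k]; the second term is at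
   most [|z|^2 / 2] and is absorbed on the left. *)
suff : rnorm z ^+ 2 <= 2^-1 * (D * \sum_(k <- r) (omega mu k)^-1 * rnorm (h k) ^+ 2)
    + 2^-1 * (D^-1 * \sum_(k <- r) omega mu k * rnorm (adj (monom T k) z) ^+ 2).
  have : D^-1 * \sum_(k <- r) omega mu k * rnorm (adj (monom T k) z) ^+ 2 <=
      rnorm z ^+ 2.
    by rewrite mulrC ler_pdivrMr// mulrC.
  move: (D^-1 * _) (D * _) (rnorm z ^+ 2) => a b c; lra.
rewrite {1}zE !mulr_sumr -big_split /=; apply: ler_sum => k _.
rewrite (le_trans (Re_le_cmod _))// (le_trans (cauchy_schwarz _ _))//.
set p := rnorm (h k); set q := rnorm _; have w0 := omega_gt0 mu_adm k.
have Dw : 0 < D / omega mu k by rewrite divr_gt0.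
have -> : D^-1 * (omega mu k * q ^+ 2) = (D / omega mu k)^-1 * q ^+ 2.
  by rewrite invf_div mulrA (mulrC D^-1).
rewrite [D * _]mulrA; move: (D / omega mu k) Dw => t t0.
rewrite -subr_ge0.
have -> : 2^-1 * (t * p ^+ 2) + 2^-1 * (t^-1 * q ^+ 2) - p * q =
    2^-1 * t^-1 * (t * p - q) ^+ 2.
  by field; rewrite gt_eqF.
by rewrite mulr_ge0 ?sqr_ge0// mulr_ge0 ?invr_ge0// ltW.
Qed.

Variables (F : hilbertType R) (e : word n -> F).
Hypothesis e_basis : orthonormal_basis e.

(* [Phi v] is [K^* (v (x) -)], where [K] is the noncommutative Poisson kernel
   [h |-> \sum_k omega_k y^(k) (x) (T^k)^* h]. *)
Lemma poisson_map_exists : exists Phi : Fs mu e -> 'B(H),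
  [/\ forall h, linear (fun v => Phi v h),
      forall v h, rnorm (Phi v h) <= Num.sqrt (opnorm S) * rnorm h * rnorm v &
      forall k, Phi (ys mu e k) = monom T k].
Proof.
(* The value at [h] prescribed for the image of the unit vector [us k]. *)
pose t (h : H) (k : mindex n) := (Num.sqrt (omega mu k))%:C *: monom T k h.
have C0 (h : H) : 0 <= Num.sqrt (opnorm S) * rnorm h.
  by rewrite mulr_ge0 ?sqrtr_ge0 ?rnorm_ge0.
have tC (h : H) (r : seq (mindex n)) (c : mindex n -> R[i]) : uniq r ->
    rnorm (\sum_(k <- r) c k *: t h k) ^+ 2 <=
    (Num.sqrt (opnorm S) * rnorm h) ^+ 2 * \sum_(k <- r) cmod (c k) ^+ 2.
  move=> r_uniq.
  rewrite (eq_bigr (fun k =>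
    monom T k ((c k * (Num.sqrt (omega mu k))%:C) *: h))); last first.
    by move=> k _; rewrite /t [RHS]linearZ scalerA.
  rewrite (le_trans (row_bound _ r_uniq))// exprMn sqr_sqrtr ?opnorm_ge0//.
  rewrite -mulrA ler_wpM2l ?opnorm_ge0// mulr_sumr.
  apply: ler_sum => k _; have w0 := omega_gt0 mu_adm k.
  rewrite rnormZ cmodM cmod_real ger0_norm ?sqrtr_ge0// !exprMn sqr_sqrtr ?(ltW w0)//.
  by rewrite le_eqVlt; apply/orP; left; apply/eqP; field; rewrite gt_eqF.
have ext h := onb_extension (us_basis mu_adm e_basis) (C0 h) (tC h).
have [L LP] := choice ext.
have Lu h k : L h (us mu e k) = t h k by have [_ _ -> _] := LP h.
(* [L h] was chosen for each [h] separately, so linearity in [h] has to be recovered from agreement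
   on the basis. *)
have L1 v : linear (fun h => L h v).
  move=> a g h; have [l1 b1 _ _] := LP (a *: g + h).
  have [l2 b2 _ _] := LP g; have [l3 b3 _ _] := LP h.
  have D0 : 0 <= cmod a * (Num.sqrt (opnorm S) * rnorm g) + Num.sqrt (opnorm S) * rnorm h.
    by rewrite addr_ge0 ?mulr_ge0 ?rnorm_ge0 ?sqrtr_ge0.
  apply: (onb_eq_on (us_basis mu_adm e_basis) (g := fun v => a *: L g v + L h v)
    l1 _ (C0 _) D0 b1).
  - move=> b x y; rewrite l2 l3 !scalerDr !scalerA (mulrC b) -!addrA; congr (_ + _).
    by rewrite addrCA.
  - move=> x; rewrite (le_trans (rnormD _ _))// rnormZ mulrDl -mulrA.
    by rewrite lerD// ler_wpM2l ?rnorm_ge0.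
  - by move=> k; rewrite !Lu /t linearP scalerDr !scalerA mulrC.
have LC v h : rnorm (L h v) <= Num.sqrt (opnorm S) * rnorm h * rnorm v.
  by have [_ + _ _] := LP h; apply.
have [Phi PhiE] : exists Phi : Fs mu e -> 'B(H), forall v h, Phi v h = L h v.
  have Phi_v (v : Fs mu e) : exists A : 'B(H), forall h, A h = L h v.
    apply: (@bop_exists _ _ _ (Num.sqrt (opnorm S) * rnorm v) (L1 v)) => h.
    by rewrite mulrAC.
  by have [Phi PhiE] := choice Phi_v; exists Phi.
exists Phi; split => [h|v h|k].
- by move=> a x y; rewrite !PhiE; have [-> _ _ _] := LP h.
- by rewrite PhiE.
- apply: bop_ext => h; rewrite PhiE (ys_us mu_adm).
  have [l1 _ _ _] := LP h; rewrite (linear_fZ _ _ l1) Lu /t scalerA -rmorphM.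
  by rewrite mulVf ?scale1r// gt_eqF// sqrtr_gt0 omega_gt0.
Qed.

End PoissonKernel.

(** * Neumann series, Gram-Schmidt and operator matrices *)

Section Neumann.
Variables (R : realType) (X : hilbertType R).

Lemma bop_cvg (T : Type) (F : set_system T) (FF : Filter F) (A : 'B(X))
    (f : T -> X) (x : X) : f @ F --> x -> (fun t => A (f t)) @ F --> A x.
Proof.
move=> /cvg_rnormP fx; have [C C0 AC] := bop_bounded A.
apply/cvg_rnormP => eps eps0; have C1 : 0 < C + 1 by rewrite ltr_wpDl.
have := fx _ (divr_gt0 eps0 C1); apply: filterS => t ft.
rewrite -linearB (le_lt_trans (AC _))//.
apply: (@le_lt_trans _ _ ((C + 1) * rnorm (x - f t))).
  by rewrite ler_wpM2r ?rnorm_ge0// lerDl.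
by rewrite mulrC -ltr_pdivlMr.
Qed.

(** The inverse is the pointwise limit of the geometric sums [P N]; both products with [1 - Q]
    telescope to [1 - Q ^+ N], which tends pointwise to the identity. *)
Lemma neumann (Q : 'B(X)) (q : R) : 0 <= q < 1 -> rbounded q Q ->
  exists L : 'B(X), L * (1 - Q) = 1 /\ (1 - Q) * L = 1.
Proof.
move=> /andP[q0 q1] Qq.
have QX N x : rnorm ((Q ^+ N) x) <= q ^+ N * rnorm x.
  elim: N => [|N IH]; first by rewrite !expr0 mul1r.
  rewrite exprS bopME (le_trans (Qq _))// exprS -mulrA.
  by rewrite ler_wpM2l.
have q1' : 0 < 1 - q by rewrite subr_gt0.
have q_sum N : \sum_(j < N) q ^+ j <= (1 - q)^-1.
  rewrite -[leRHS]mul1r ler_pdivlMr// mulrC -opprB mulNr -subrX1 opprB.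
  by rewrite gerBl exprn_ge0.
pose P N := \sum_(j < N) Q ^+ j.
have PQ N : P N * (1 - Q) = 1 - Q ^+ N.
  rewrite -[1 - Q]opprB mulrN -[1 - Q ^+ N]opprB subrX1; congr (- _).
  apply: commr_sym; apply: commr_sum => j _.
  by apply: commrX; apply: commr_sym; apply: commrB => //; exact: commr1.
have QP N : (1 - Q) * P N = 1 - Q ^+ N.
  by rewrite -[1 - Q]opprB mulNr -[1 - Q ^+ N]opprB subrX1.
have P_bound N : rbounded (1 - q)^-1 (P N).
  move=> x; rewrite bop_sumE (le_trans (rnorm_sum _ _))//.
  apply: (@le_trans _ _ (\sum_(j < N) q ^+ j * rnorm x)).
    by apply: ler_sum => j _; exact: QX.
  by rewrite -mulr_suml ler_wpM2r ?rnorm_ge0.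
have P_cvg x : setT x -> cvg ((fun N => P N x) @ \oo).
  move=> _; rewrite (_ : (fun N => P N x) = series (fun j => (Q ^+ j) x)).
    apply: (@cvg_series_summable _ _ _ (fun j => q ^+ j * rnorm x)
      ((1 - q)^-1 * rnorm x)) => [j|N]; first exact: QX.
    by rewrite big_mkord -mulr_suml ler_wpM2r ?rnorm_ge0.
  by apply/funext => N; rewrite bop_sumE /series /= big_mkord.
have XT : cspan [set: X] = setT.
  by apply/seteqP; split => // x _ M [_]; apply.
have q1_ge0 : 0 <= (1 - q)^-1 by rewrite invr_ge0 ltW.
have [l [ll lC Pl]] := cvg_net _ (fun N => bop_linear (P N)) q1_ge0 P_bound XT P_cvg.
have [L Ll] := bop_exists ll lC.
have QN0 x : (fun N => (1 - Q ^+ N) x) @ \oo --> x.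
  apply/cvg_rnormP => eps eps0.
  have x1 : 0 < rnorm x + 1 by rewrite ltr_wpDl ?rnorm_ge0.
  have /cvg_expr/cvgrPdist_lt/(_ _ (divr_gt0 eps0 x1)) : `|q| < 1.
    by rewrite ger0_norm.
  apply: filterS => N; rewrite sub0r normrN ger0_norm ?exprn_ge0// => qN.
  rewrite bopDE bop1E bopNE opprB addrC subrK (le_lt_trans (QX _ _))//.
  apply: (@le_lt_trans _ _ (q ^+ N * (rnorm x + 1))).
    by rewrite ler_wpM2l ?exprn_ge0// lerDl.
  by rewrite -ltr_pdivlMr.
exists L; split; apply: bop_ext => x; rewrite bopME bop1E.
- apply: (cvg_unique (@norm_hausdorff _ X) _ (QN0 x)).
  rewrite Ll; have := Pl ((1 - Q) x).
  by under eq_cvg do rewrite -bopME PQ.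
- have QPx : (fun N => (1 - Q) (P N x)) = (fun N => (1 - Q ^+ N) x).
    by apply/funext => N; rewrite -bopME QP.
  apply: (cvg_unique (@norm_hausdorff _ X) _ (QN0 x)).
  by rewrite -QPx Ll; apply: bop_cvg; exact: Pl.
Qed.

(** Makes the [sup] in [spectral_radius] a true supremum whenever the spectrum is nonempty. *)
Lemma spectrum_bounded (A : 'B(X)) l : spectrum A l -> cmod l <= opnorm A.
Proof.
move=> Al; rewrite leNgt; apply/negP => l_gt; apply: Al.
have l0 : 0 < cmod l := le_lt_trans (opnorm_ge0 A) l_gt.
have l_neq0 : l != 0 by rewrite -(rnorm_eq0 (l : R[i]^o)) gt_eqF.
have Alq : rbounded (opnorm A / cmod l) (l^-1 *: A).
  move=> x; rewrite bopZE rnormZ.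
  have -> : cmod l^-1 = (cmod l)^-1.
    by apply: complexI; rewrite fmorphV /= -!rnormE normfV.
  by rewrite mulrAC mulrC ler_wpM2r ?invr_ge0 ?rnorm_ge0// opnormP.
have q01 : 0 <= opnorm A / cmod l < 1.
  by rewrite divr_ge0 ?opnorm_ge0 ?rnorm_ge0// ltr_pdivrMr// mul1r.
have [L [L1 L2]] := neumann q01 Alq.
have AlE : A - l *: (1 : 'B(X)) = - l *: (1 - l^-1 *: A).
  by rewrite scalerBr scalerA mulNr mulfV// scaleN1r opprK addrC scaleNr.
exists (- l^-1 *: L); rewrite AlE; split.
- rewrite bop_scalerAl bop_scalerAr scalerA mulNr mulrN opprK.
  by rewrite mulVf// scale1r.
- rewrite bop_scalerAl bop_scalerAr scalerA mulNr mulrN opprK.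
  by rewrite mulfV// scale1r.
Qed.

Lemma sup_ge0 (A : set R) : (forall x, A x -> 0 <= x) -> 0 <= sup A.
Proof.
move=> A0; have [As|] := pselect (has_sup A); last by move/sup_out ->.
by have [x Ax] := As.1; rewrite (le_trans (A0 _ Ax))// sup_upper_bound.
Qed.

End Neumann.

Lemma spectral_radius_le (R : realType) (X K : hilbertType R) (A : 'B(X)) (B : 'B(K)) :
  spectrum B `<=` spectrum A -> spectral_radius B <= spectral_radius A.
Proof.
move=> BA; have [[l Bl]|B0] := pselect (spectrum B !=set0).
  apply: sup_le_ub; first by exists (cmod l), l.
  move=> _ [l' /BA Al' <-]; apply: sup_upper_bound; last by exists l'.
  split; first by exists (cmod l'), l'.
  by exists (opnorm A) => _ [l'' Al'' <-]; exact: spectrum_bounded.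
(* Empty spectrum, as on the zero space: the left side is the default value 0. *)
rewrite /spectral_radius (_ : [set _ | _ in spectrum B] = set0) ?sup0.
  by apply: sup_ge0 => _ [l _ <-]; exact: rnorm_ge0.
by apply/seteqP; split => // x [l Bl _]; apply: B0; exists l.
Qed.

Section GramSchmidt.
Variables (R : realType) (H : hilbertType R).

(** Zero vectors are allowed, so dependent vectors need not be discarded and the family stays
    indexed like the input. *)
Definition orthogonal_units (f : nat -> H) : Prop :=
  (forall p q, p != q -> ip (f p) (f q) = 0) /\
  (forall p, f p = 0 \/ rnorm (f p) = 1).

Lemma gram_schmidt (s : seq H) : exists2 f, orthogonal_units f &
  forall x, x \in s -> x = \sum_(p < size s) ip x (f p) *: f p.
Proof.
elim: s => [|x0 s [f [f_orth f1] sf]].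
  by exists (fun=> 0) => //; split => [p q _|p]; [rewrite ip0l|left].
set N := size s; pose P x := \sum_(p < N) ip x (f p) *: f p.
(* If [x0] depends on the earlier vectors, then [g = 0] and [g1 = 0] as well. *)
pose g := x0 - P x0; pose g1 := (rnorm g)^-1%:C *: g.
have g_f q : (q < N)%N -> ip g (f q) = 0.
  move=> qN; rewrite ipBl ip_suml (bigD1 (Ordinal qN))//= big1 ?addr0 ?ipZl.
    by case: (f1 q) => [->|fq]; rewrite ?ip0r ?mul0r ?subrr// ipxx fq expr1n mulr1 subrr.
  by move=> p pq; rewrite ipZl f_orth ?mulr0.
have g1_f q : (q < N)%N -> ip g1 (f q) = 0 by move=> qN; rewrite ipZl g_f ?mulr0.
have f_g1 q : (q < N)%N -> ip (f q) g1 = 0 by move=> qN; rewrite ip_conj g1_f// conjc0.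
(* Beyond [N] the values are reset to 0, since only the [f q] with [q < N] are known to be
   orthogonal to [g1]. *)
pose f' p := if (p < N)%N then f p else if p == N then g1 else 0.
have f'f (p : 'I_N) : f' p = f p by rewrite /f' ltn_ord.
have f'N : f' N = g1 by rewrite /f' ltnn eqxx.
exists f'; first split.
- move=> p q pq; rewrite /f'.
  case: (boolP (p < N)%N) => pN; case: (boolP (q < N)%N) => qN.
  + exact: f_orth.
  + by case: ifPn => _; [exact: f_g1|exact: ip0r].
  + by case: ifPn => _; [exact: g1_f|exact: ip0l].
  + have [pE|_] := eqVneq p N; last exact: ip0l.
    by rewrite -pE eq_sym (negbTE pq) ip0r.
- move=> p; rewrite /f'; case: ifP => // _; case: ifP => _; last by left.
  have [g0|g0] := eqVneq g 0; first by left; rewrite /g1 g0 scaler0.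
  right; rewrite rnormZ cmod_real ger0_norm ?invr_ge0 ?rnorm_ge0// mulVf//.
  by rewrite rnorm_eq0.
move=> x; rewrite inE big_ord_recr /= f'N.
have -> : \sum_(p < N) ip x (f' p) *: f' p = P x.
  by apply: eq_bigr => p _; rewrite f'f.
case/predU1P => [->|xs].
  have -> : ip x0 g1 *: g1 = g; last by rewrite addrC subrK.
  have x0E : x0 = P x0 + g by rewrite addrC subrK.
  have Pg1 : ip (P x0) g1 = 0.
    by rewrite ip_suml big1// => p _; rewrite ipZl f_g1 ?mulr0.
  rewrite {1}x0E ipDl Pg1 add0r ipZr conjC_real ipxx scalerA -!rmorphM.
  have [->|g0] := eqVneq g 0; first by rewrite scaler0.
  rewrite (_ : _ * _ = 1) ?scale1r//.
  by field; rewrite rnorm_eq0.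
have -> : ip x g1 = 0; last by rewrite scale0r addr0; exact: sf.
by rewrite (sf x xs) ip_suml big1// => p _; rewrite ipZl f_g1 ?mulr0.
Qed.

End GramSchmidt.

Section OperatorMatrix.
Variables (R : realType) (H : hilbertType R) (m : nat).
Implicit Types (A : 'M['B(H)]_m) (x : 'I_m -> H).

Lemma mx_opnormP A x : \sum_(j < m) rnorm (x j) ^+ 2 <= 1 ->
  Num.sqrt (\sum_(i < m) rnorm (\sum_(j < m) A i j (x j)) ^+ 2) <= mx_opnorm A.
Proof.
move=> x1; apply: sup_upper_bound; last by exists x.
split; first by exists (Num.sqrt (\sum_(i < m) rnorm (\sum_(j < m) A i j (x j)) ^+ 2)), x.
(* A crude bound by the norms of the entries, enough for the supremum to exist. *)
exists (Num.sqrt (\sum_(i < m) (\sum_(j < m) opnorm (A i j)) ^+ 2)) => _ [y /= y1 <-].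
rewrite ler_sqrt; last by apply: sumr_ge0 => i _; rewrite sqr_ge0.
apply: ler_sum => i _; rewrite ler_pXn2r ?nnegrE ?rnorm_ge0//; last first.
  by apply: sumr_ge0 => j _; exact: opnorm_ge0.
rewrite (le_trans (rnorm_sum _ _))//; apply: ler_sum => j _.
rewrite (le_trans (opnormP _ _))// ler_piMr ?opnorm_ge0//.
rewrite -(@expr_le1 _ 2) ?rnorm_ge0// (le_trans _ y1)// (bigD1 j)//= lerDl.
by apply: sumr_ge0 => i' _; rewrite sqr_ge0.
Qed.

(** [mx_opnorm] tests the unit ball only; rescaling by the norm of [x] gives all vectors. *)
Lemma mx_opnorm_le1 A x : mx_opnorm A <= 1 ->
  \sum_(i < m) rnorm (\sum_(j < m) A i j (x j)) ^+ 2 <= \sum_(j < m) rnorm (x j) ^+ 2.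
Proof.
move=> A1; set t := \sum_(j < m) rnorm (x j) ^+ 2.
have t_ge0 : 0 <= t by apply: sumr_ge0 => j _; rewrite sqr_ge0.
have [t0|t0] := eqVneq t 0.
  rewrite big1 ?t0// => i _; rewrite big1 ?rnorm0 ?expr0n// => j _.
  suff -> : x j = 0 by rewrite linear0.
  apply/eqP; rewrite -rnorm_eq0 -sqrf_eq0.
  have /eqP := t0; rewrite psumr_eq0 => [|k _]; last exact: sqr_ge0.
  by move=> /allP/(_ j (mem_index_enum _)).
have t_gt0 : 0 < t by rewrite lt_def t0.
pose a := (Num.sqrt t)^-1; pose y j := a%:C *: x j.
have a2 : a ^+ 2 = t^-1 by rewrite exprVn sqr_sqrtr.
have yE (v : H) : rnorm (a%:C *: v) ^+ 2 = t^-1 * rnorm v ^+ 2.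
  by rewrite rnormZ cmod_real exprMn real_normK ?num_real// a2.
have y1 : \sum_(j < m) rnorm (y j) ^+ 2 <= 1.
  by under eq_bigr do rewrite yE; rewrite -mulr_sumr mulVf.
have := le_trans (mx_opnormP A y1) A1.
have -> : \sum_(i < m) rnorm (\sum_(j < m) A i j (y j)) ^+ 2 =
    t^-1 * \sum_(i < m) rnorm (\sum_(j < m) A i j (x j)) ^+ 2.
  rewrite mulr_sumr; apply: eq_bigr => i _; rewrite -yE; congr (rnorm _ ^+ 2).
  by rewrite scaler_sumr; apply: eq_bigr => j _; rewrite linearZ.
rewrite -(@ler_pXn2r _ 2) ?nnegrE ?sqrtr_ge0// sqr_sqrtr; last first.
  by rewrite mulr_ge0 ?invr_ge0// sumr_ge0// => i _; rewrite sqr_ge0.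
by rewrite expr1n mulrC ler_pdivrMr// mul1r.
Qed.

Lemma mx_opnorm_le A (C : R) : 0 <= C ->
  (forall x, \sum_(i < m) rnorm (\sum_(j < m) A i j (x j)) ^+ 2 <=
             C ^+ 2 * \sum_(j < m) rnorm (x j) ^+ 2) ->
  mx_opnorm A <= C.
Proof.
move=> C0 AC; apply: sup_le_ub.
  exists (Num.sqrt (\sum_(i < m) rnorm (\sum_(j < m) A i j 0) ^+ 2)), (fun=> 0) => //=.
  by rewrite big1// => j _; rewrite rnorm0 expr0n.
move=> _ [x /= x1 <-]; rewrite -[leRHS](ger0_norm C0) -sqrtr_sqr.
rewrite ler_sqrt ?sqr_ge0// (le_trans (AC x))//.
by rewrite ler_piMr ?sqr_ge0.
Qed.

End OperatorMatrix.

(** * The functional calculus *)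

Lemma closed_eq0 (T : topologicalType) (R : realType) (I : Type)
    (g : I -> T -> R[i]^o) : (forall i, continuous (g i)) ->
  closed [set t | forall i, g i t = 0].
Proof.
move=> gc t ct i; have gi_closed : closed (g i @^-1` [set 0]).
  apply: closed_comp => [x _|]; first exact: gc.
  exact/accessible_closed_set1/hausdorff_accessible/norm_hausdorff.
by apply: gi_closed; apply: closureS ct => x /= /(_ i).
Qed.

Section WstarAlgebra.
Variables (R : realType) (H : hilbertType R).

Definition commutant (I : Type) (G : I -> 'B(H)) : set 'B(H) :=
  [set A | forall i, A * G i = G i * A].

Lemma wstar_algebra_commutant (I : Type) (G : I -> 'B(H)) :
  (forall i j, G i * G j = G j * G i) ->
  wstar_algebra (range G) `<=` commutant G.
Proof.
move=> GC A; apply; split; last by move=> _ [j _ <-] i.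
split; first split.
- by move=> i; rewrite mul1r mulr1.
- move=> a B C BC CC i.
  by rewrite mulrDl mulrDr bop_scalerAl bop_scalerAr BC CC.
- by move=> B C BC CC i; rewrite -mulrA CC mulrA BC mulrA.
(* Commutation with [G i] amounts to [<A (G i x), y> = <A x, (G i)^* y>] for all [x] and [y], and
   both sides are w*-continuous in [A]. *)
pose g (p : I * H * H) (B : wstar H) : R[i]^o :=
  ip (B (G p.1.1 p.1.2)) p.2 - ip (B p.1.2) (adj (G p.1.1) p.2).
rewrite (_ : commutant G = [set B | forall p, g p B = 0]).
  apply: closed_eq0 => -[[i x] y] B.
  by apply: cvgB; [exact: nbhs_filter B| |];
    exact: (@cvg_wstar_ip _ _ (wstar H) _ (nbhs_filter B) id B _ _ (@cvg_id _ _)).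
apply/seteqP; split=> [B BC [[i x] y]|B Bg i].
  by rewrite /g /= -adjP -!bopME BC subrr.
apply: bop_ext => x; apply: ip_injl => y; apply/eqP; rewrite -subr_eq0.
by have /eqP := Bg (i, x, y); rewrite /g /= -adjP.
Qed.

Lemma wstar_algebra_subalgebra (G : set 'B(H)) : subalgebra (wstar_algebra G).
Proof.
split=> [M [[[M1 _ _] _] _]//|a A B GA GB M MG|A B GA GB M MG].
  by have [[[_ ML _] _] _] := MG; apply: ML; [exact: GA|exact: GB].
by have [[[_ _ MM] _] _] := MG; apply: MM; [exact: GA|exact: GB].
Qed.

Lemma sub_wstar_algebra (G : set 'B(H)) : G `<=` wstar_algebra G.
Proof. by move=> A GA M [_]; apply. Qed.

Lemma subalgebra_wordpow (M : set 'B(H)) n (T : 'I_n -> 'B(H)) (a : word n) :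
  subalgebra M -> (forall i, M (T i)) -> M (wordpow T a).
Proof.
move=> [M1 _ MM] MT; rewrite /wordpow.
by elim/big_ind : _ => // A B; exact: MM.
Qed.

Lemma subalgebra_sum (M : set 'B(H)) (I : Type) (r : seq I) (c : I -> R[i])
    (A : I -> 'B(H)) : subalgebra M -> (forall i, M (A i)) ->
  M (\sum_(i <- r) c i *: A i).
Proof.
move=> [M1 ML MM] MA; elim/big_rec : _ => [|i B _ MB]; last exact: ML.
by have := ML (-1) 1 1 M1 M1; rewrite scaleN1r addNr.
Qed.

End WstarAlgebra.

Lemma rnorm_lim_le (R : realType) (V : normedModType R[i]) (T : Type)
    (F : set_system T) (FF : ProperFilter F) (f : T -> V) (y : V) (B : R) :
  f @ F --> y -> (\forall t \near F, rnorm (f t) <= B) -> rnorm y <= B.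
Proof.
move=> /cvg_rnormP fy fB; rewrite -subr_le0; apply: (@le0_eps _ _ 1) => // e e0.
have [t [ft yt]] := filter_ex (filterI fB (fy e e0)).
rewrite mul1r lerBlDr -[in leLHS](subrK (f t) y).
by rewrite (le_trans (rnormD _ _))// lerD// ltW.
Qed.

Section Calculus.
Variables (R : realType) (n : nat) (mu : word n -> R).
Hypothesis mu_adm : admissible_weights mu.
Variables (F : hilbertType R) (e : word n -> F).
Hypothesis e_basis : orthonormal_basis e.
Variables (H : hilbertType R) (T : 'I_n -> 'B(H)) (S : 'B(H)).
Hypotheses (TC : forall i j, T i * T j = T j * T i)
  (TS : wot_sum (fun a : word n =>
      (bmu mu a ^- 2)%:C *: (wordpow T a * adj (wordpow T a))) S).
Variable Phi : Fs mu e -> 'B(H).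
Hypotheses (Phi_linear : forall h, linear (fun v => Phi v h))
  (PhiC : forall v h, rnorm (Phi v h) <= Num.sqrt (opnorm S) * rnorm h * rnorm v)
  (Phi_ys : forall k, Phi (ys mu e k) = monom T k).

Local Notation B := (Bop_s mu e).
Local Notation Y := (ys mu e).
Local Notation one := (vacuum mu e).
Local Notation C h := (Num.sqrt (opnorm S) * rnorm h).

Lemma Phi_bound_ge0 (h : H) : 0 <= C h.
Proof. by rewrite mulr_ge0 ?sqrtr_ge0 ?rnorm_ge0. Qed.

Lemma Phi_linearP a x y : Phi (a *: x + y) = a *: Phi x + Phi y.
Proof. by apply: bop_ext => h; rewrite Phi_linear. Qed.

Lemma Phi_cvg (U : Type) (G : set_system U) (GF : Filter G) (v : U -> Fs mu e) w h :
  v @ G --> w -> (fun u => Phi (v u) h) @ G --> Phi w h.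
Proof.
move=> /cvg_rnormP vw; apply/cvg_rnormP => eps eps0.
have C1 : 0 < C h + 1 by rewrite ltr_wpDl ?Phi_bound_ge0.
have := vw _ (divr_gt0 eps0 C1); apply: filterS => u vu.
rewrite -(linear_fB _ _ (Phi_linear h)) (le_lt_trans (PhiC _ _))//.
apply: (@le_lt_trans _ _ ((C h + 1) * rnorm (w - v u))).
  by rewrite ler_wpM2r ?rnorm_ge0// lerDl.
by rewrite mulrC -ltr_pdivlMr.
Qed.

Lemma Phi_riesz h g : exists w, forall v, ip (Phi v h) g = ip v w.
Proof.
apply: (@riesz _ _ (fun v => ip (Phi v h) g) (C h * rnorm g)) => [a u v|v].
  by rewrite Phi_linear ip_linearl.
rewrite (le_trans (cauchy_schwarz _ _))// mulrAC.
by rewrite ler_wpM2r ?rnorm_ge0.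
Qed.

Lemma Phi_one : Phi one = 1.
Proof. by rewrite vacuumE Phi_ys monom0. Qed.

Lemma eq_on_ys (f g : Fs mu e -> H) (D1 D2 : R) : linear f -> linear g ->
  0 <= D1 -> 0 <= D2 -> rbounded D1 f -> rbounded D2 g ->
  (forall k, f (Y k) = g (Y k)) -> f =1 g.
Proof.
move=> fl gl D10 D20 fD gD fg.
apply: (eq_on_cspan (cspan_ys mu e) fl gl D10 D20 fD gD).
by move=> _ [k _ <-].
Qed.

Lemma Phi_comp_linear (A : 'B(Fs mu e)) h : linear (fun v => Phi (A v) h).
Proof. by move=> a x y; rewrite linearP Phi_linearP. Qed.

Lemma Phi_comp_bounded (A : 'B(Fs mu e)) h :
  rbounded (C h * opnorm A) (fun v => Phi (A v) h).
Proof.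
move=> v; rewrite (le_trans (PhiC _ _))// -[leRHS]mulrA ler_wpM2l ?Phi_bound_ge0//.
exact: opnormP.
Qed.

Lemma comp_Phi_linear (A : 'B(H)) h : linear (fun v => A (Phi v h)).
Proof. by move=> a x y; rewrite Phi_linear linearP. Qed.

Lemma comp_Phi_bounded (A : 'B(H)) h :
  rbounded (opnorm A * C h) (fun v => A (Phi v h)).
Proof.
by move=> v; rewrite (le_trans (opnormP _ _))// -[leRHS]mulrA ler_wpM2l ?opnorm_ge0.
Qed.

Let opC_ge0 (X : hilbertType R) (A : 'B(X)) (h : H) : 0 <= C h * opnorm A.
Proof. by rewrite mulr_ge0 ?Phi_bound_ge0 ?opnorm_ge0. Qed.

(** On [y^(k)] both sides equal [T^(k + e_i)]. *)
Lemma Phi_Bop i v : Phi (B i v) = T i * Phi v.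
Proof.
apply: bop_ext => h; rewrite bopME; move: v.
apply: (eq_on_ys (Phi_comp_linear _ _) (comp_Phi_linear _ _) (opC_ge0 _ _) _
  (Phi_comp_bounded _ _) (comp_Phi_bounded _ _)).
  by rewrite mulrC opC_ge0.
by move=> k; rewrite Bop_ys// !Phi_ys monom_incr.
Qed.

(** Needed to move [Phi (A one)] past [T i] in [Phi_mul]. *)
Lemma Phi_comm i v : Phi v * T i = T i * Phi v.
Proof.
apply: bop_ext => h; rewrite !bopME; move: v.
apply: (eq_on_ys (Phi_linear _) (comp_Phi_linear _ _) (Phi_bound_ge0 _) _
  (fun v => PhiC v _) (comp_Phi_bounded _ _)).
  by rewrite mulrC opC_ge0.
move=> k; rewrite Phi_ys -!bopME; congr (bop_fun _ h).
apply: commr_sym; apply: commr_prod => j _; apply: commrX; exact: TC.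
Qed.

(** By density [v] may be [y^(k) = B_a 1], and one inducts on the word [a]: [Phi (A B_i w) = Phi
    (B_i A w) = T_i Phi (A w) = T_i Phi (A 1) Phi w], where [T_i] commutes with [Phi (A 1)]. *)
Lemma Phi_mul A v : commutant B A -> Phi (A v) = Phi (A one) * Phi v.
Proof.
move=> AC; apply: bop_ext => h; rewrite bopME; move: v.
apply: (eq_on_ys (Phi_comp_linear _ _) (comp_Phi_linear _ _) (opC_ge0 _ _) _
  (Phi_comp_bounded _ _) (comp_Phi_bounded _ _)).
  by rewrite mulrC opC_ge0.
move=> k; rewrite -bopME; congr (bop_fun _ h).
have [a <-] := wtype_onto k.
rewrite Phi_ys -(monom_Bop_vacuum mu_adm e_basis) -(wordpowE TC).
rewrite -(wordpowE (Bop_comm mu_adm e_basis)).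
elim: a => [|i a IH]; first by rewrite /wordpow !big_nil bop1E mulr1.
rewrite /wordpow !big_cons -/(wordpow _ a) bopME -[A (B i _)]bopME AC bopME.
by rewrite Phi_Bop IH mulrA -Phi_comm mulrA.
Qed.

Lemma Fs_infty_comm A : Fs_infty mu e A -> commutant B A.
Proof.
by apply: wstar_algebra_commutant => i j; exact: Bop_comm.
Qed.

(* Fejer means are averages with weights in [0, 1], hence contractions, and
   they converge on each [y^(k)]. *)
Lemma fejer_cvg (A : 'B(Fs mu e)) c : fourier A c ->
  (fejer c T : nat -> sot H) @ \oo --> (Phi (A one) : sot H).
Proof.
move=> /(fourier_coef mu_adm e_basis) cE; apply/cvg_sotP => h.
pose u := us mu e.
have uB : orthonormal_basis u := us_basis mu_adm e_basis.
pose D N : {fset mindex n} := fset_set [set k : mindex n | (deg k <= N)%N].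
have inD N (k : mindex n) : (k \in D N) = (deg k <= N)%N.
  rewrite in_fset_set; last exact: finite_mindex.
  by apply/idP/idP; rewrite inE.
pose w N (k : mindex n) : R := 1 - (deg k)%:R / N.+1%:R.
have w01 N (k : mindex n) : k \in D N -> 0 <= w N k <= 1.
  rewrite inD => kN; rewrite subr_ge0 ler_pdivrMr// mul1r ler_nat ltnW//=.
  by rewrite gerBl divr_ge0.
(* The Fejer mean is taken in [F_s^2], before [Phi], where it is diagonal in an orthonormal basis;
   [fejer c T N] is then [Phi (L N (A one))]. *)
pose L N (v : Fs mu e) := \sum_(k <- D N) ((w N k)%:C * ip v (u k)) *: u k.
have L_lin N : linear (L N).
  move=> a x y; rewrite /L scaler_sumr -big_split; apply: eq_bigr => k _.
  by rewrite /= ip_linearl mulrDr scalerDl mulrCA -[(a * _) *: _]scalerA.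
have L1 N : rbounded 1 (L N).
  move=> v; rewrite mul1r -(@ler_pXn2r _ 2) ?nnegrE ?rnorm_ge0//.
  rewrite /L pythagoras ?fset_uniq//; last first.
    by move=> j k jk; rewrite ipZl ipZr (onb_orth uB) ?mulr0.
  apply: le_trans (onb_bessel uB v (fset_uniq (D N))).
  rewrite !big_seq; apply: ler_sum => k kD.
  rewrite rnormZ (onb_rnorm uB) mulr1 cmodM exprMn cmod_real.
  have /andP[w0 w1] := w01 N k kD.
  by rewrite ger0_norm// ler_piMl ?sqr_ge0// exprn_ile1.
have Lu v : range u v -> L^~ v @ \oo --> v.
  move=> [k _ <-]; apply/cvg_rnormP => eps eps0.
  (* The weight of [u k] differs from 1 by [deg k / (N + 1)]. *)
  have k0 : 0 < (deg k)%:R + 1 :> R by rewrite ltr_wpDl.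
  have deg_near : \forall N \near \oo, (deg k <= N)%N by exists (deg k).
  have inv_near := near_infty_natSinv_lt (PosNum (divr_gt0 eps0 k0)).
  apply: filterS (filterI deg_near inv_near) => N [kN /= Neps].
  have -> : L N (u k) = (w N k)%:C *: u k.
    rewrite /L (bigD1_seq k) ?fset_uniq ?inD//= uB.1 eqxx mulr1 big1 ?addr0//.
    by move=> j jk; rewrite (onb_orth uB) ?mulr0 ?scale0r// eq_sym.
  rewrite -[X in X - _]scale1r -scalerBl rnormZ (onb_rnorm uB) mulr1.
  rewrite -[1]/(1%:C) -rmorphB cmod_real opprB addrC subrK ger0_norm ?divr_ge0//.
  apply: (@le_lt_trans _ _ (N.+1%:R^-1 * ((deg k)%:R + 1))).
    by rewrite mulrC ler_wpM2l ?invr_ge0// lerDl.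
  by rewrite -ltr_pdivlMr.
have LA : L^~ (A one) @ \oo --> A one.
  have id_linear : linear (@id (Fs mu e)) by [].
  apply: (@cvg_net_unique _ _ _ _ _ _ _ _ L_lin ler01 L1 _ id 1
    uB.2 id_linear ler01) => //.
  by move=> v; rewrite mul1r.
suff fE : (fun N => fejer c T N h) = (fun N => Phi (L N (A one)) h).
  by rewrite fE; apply: Phi_cvg; exact: LA.
apply/funext => N; rewrite /L (linear_fsum _ _ _ (Phi_linear h)).
rewrite /fejer fsbig_finite; last exact: finite_mindex.
rewrite bop_sumE; apply: eq_bigr => k _.
rewrite (linear_fZ _ _ (Phi_linear h)) /u /us (linear_fZ _ _ (Phi_linear h)) Phi_ys.
rewrite bopZE scalerA cE ipZr conjC_real; congr (_ *: _).
rewrite -[RHS]mulrA [in RHS]mulrAC -rmorphM -expr2.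
rewrite sqr_sqrtr ?(ltW (omega_gt0 mu_adm k))//; congr (_ * _).
by rewrite rmorphB rmorph1 fmorph_div !rmorph_nat.
Qed.

Lemma calculus_exists : is_calculus T (fun A => Phi (A one)).
Proof.
move=> A _; split; last by move=> c; exact: fejer_cvg.
eexists; exact: fourier_exists.
Qed.

(** SOT limits are unique, so every calculus is [Phi (A one)] on [F_s^infty]; all its properties are
    proved through this formula. *)
Lemma calculus_unique (Psi : 'B(Fs mu e) -> 'B(H)) : is_calculus T Psi ->
  forall A, Fs_infty mu e A -> Psi A = Phi (A one).
Proof.
move=> PsiP A /PsiP[[c Ac] /(_ c Ac) PsiA]; apply: bop_ext => h.
have /cvg_sotP/(_ h) PsiAh := PsiA.
have /cvg_sotP/(_ h) PhiAh := fejer_cvg Ac.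
exact: (cvg_unique (@norm_hausdorff _ H) PsiAh PhiAh).
Qed.

End Calculus.

(** * Complete boundedness, continuity, multiplicativity and spectra of the calculus *)

Section CalculusProperties.
Variables (R : realType) (n : nat) (mu : word n -> R).
Hypothesis mu_adm : admissible_weights mu.
Variables (F : hilbertType R) (e : word n -> F).
Hypothesis e_basis : orthonormal_basis e.
Variables (H : hilbertType R) (T : 'I_n -> 'B(H)) (S : 'B(H)).
Hypotheses (TC : forall i j, T i * T j = T j * T i)
  (TS : wot_sum (fun a : word n =>
      (bmu mu a ^- 2)%:C *: (wordpow T a * adj (wordpow T a))) S).
Variable Phi : Fs mu e -> 'B(H).
Hypotheses (Phi_linear : forall h, linear (fun v => Phi v h))
  (PhiC : forall v h, rnorm (Phi v h) <= Num.sqrt (opnorm S) * rnorm h * rnorm v)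
  (Phi_ys : forall k, Phi (ys mu e k) = monom T k).

Local Notation B := (Bop_s mu e).
Local Notation Y := (ys mu e).
Local Notation one := (vacuum mu e).
Local Notation D := (Fs_infty mu e).

(* The Hilbert tensor product of [Fs] and [H] is avoided by writing its
   elements as finite sums over the orthogonal vectors [f p]. *)
Lemma Phi_row (m : nat) (f : nat -> H) (v : 'I_m -> Fs mu e) :
  orthogonal_units f ->
  rnorm (\sum_(p < m) Phi (v p) (f p)) ^+ 2 <=
  opnorm S * \sum_(p < m) rnorm (v p) ^+ 2.
Proof.
move=> [f_orth f1]; pose u := us mu e.
have uB : orthonormal_basis u := us_basis mu_adm e_basis.
pose P (K : {fset mindex n}) (x : Fs mu e) := \sum_(k <- K) ip x (u k) *: u k.
have Pcvg x : P^~ x @ summability.totally --> x.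
  have := @onb_expansion _ _ _ _ uB x; rewrite /norm_sum.
  rewrite (_ : summability.partial_sum _ = P^~ x)//.
  by apply/funext => K; rewrite partial_sumE.
have PhiPcvg : (fun K => \sum_(p < m) Phi (P K (v p)) (f p)) @ summability.totally
    --> \sum_(p < m) Phi (v p) (f p).
  apply: cvg_big => [|p _]; first exact: add_continuous.
  exact: (Phi_cvg Phi_linear PhiC).
set d := opnorm S * _; have d0 : 0 <= d.
  by rewrite mulr_ge0 ?opnorm_ge0// sumr_ge0// => p _; rewrite sqr_ge0.
rewrite -(sqr_sqrtr d0) ler_pXn2r ?nnegrE ?rnorm_ge0 ?sqrtr_ge0//.
apply: (rnorm_lim_le _ PhiPcvg); apply: nearW => K.
rewrite -(@ler_pXn2r _ 2) ?nnegrE ?rnorm_ge0 ?sqrtr_ge0// sqr_sqrtr//.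
(* Exchanging sums gives the row [\sum_k T^k h_k] with [h_k = \sum_p c p k f_p]. As the [f p] are
   orthogonal, [|h_k|^2] is at most [omega_k \sum_p |<v_p, u_k>|^2], and [omega_k] cancels in the
   row bound. *)
pose c p k := ip (v p) (u k) * (Num.sqrt (omega mu k))%:C.
have -> : \sum_(p < m) Phi (P K (v p)) (f p) =
    \sum_(k <- K) monom T k (\sum_(p < m) c p k *: f p).
  under [RHS]eq_bigr do rewrite linear_sum.
  rewrite exchange_big; apply: eq_bigr => p _.
  rewrite /P (linear_fsum _ _ _ (Phi_linear _)); apply: eq_bigr => k _.
  rewrite (linear_fZ _ _ (Phi_linear _)) /u /us (linear_fZ _ _ (Phi_linear _)).
  by rewrite Phi_ys scalerA linearZ.
apply: (le_trans (row_bound mu_adm TC TS _ (fset_uniq K))).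
rewrite ler_wpM2l ?opnorm_ge0//.
apply: (@le_trans _ _ (\sum_(k <- K) \sum_(p < m) cmod (ip (v p) (u k)) ^+ 2)).
  apply: ler_sum => k _; have w0 := omega_gt0 mu_adm k.
  rewrite (@pythagoras _ _ _ (fun p : 'I_m => c p k *: f p)) ?index_enum_uniq//.
    rewrite mulr_sumr; apply: ler_sum => p _.
    rewrite rnormZ cmodM cmod_real ger0_norm ?sqrtr_ge0// !exprMn.
    rewrite sqr_sqrtr ?(ltW w0)//; set b := rnorm (f p).
    have b1 : b ^+ 2 <= 1.
      by rewrite /b; case: (f1 p) => ->; rewrite ?rnorm0 ?expr0n ?expr1n ?ler01.
    rewrite (_ : _ * _ = cmod (ip (v p) (u k)) ^+ 2 * b ^+ 2).
      by rewrite ler_piMr ?sqr_ge0.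
    by field; rewrite gt_eqF.
  by move=> p q pq; rewrite ipZl ipZr f_orth ?mulr0.
rewrite exchange_big /=; apply: ler_sum => p _.
exact: (onb_bessel uB (v p) (fset_uniq K)).
Qed.

Lemma rnorm_one : rnorm one = 1.
Proof. by rewrite rnorm_cspan (onb_rnorm e_basis). Qed.

(** Expanding [x_j = \sum_p <x_j, f_p> f_p] turns row [i] into [\sum_p Phi (v_ip) f_p], to which
    [Phi_row] applies. For fixed [p], the [v_ip] are the image under [A] of the vector with entries
    [<x_j, f_p> 1], so contractivity of [A] applies, and Bessel's inequality sums over [p]. *)
Lemma mx_opnorm_Phi (m : nat) (A : 'M['B(Fs mu e)]_m) : mx_opnorm A <= 1 ->
  mx_opnorm (map_mx (fun A : 'B(Fs mu e) => Phi (A one)) A) <= Num.sqrt (opnorm S).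
Proof.
move=> A1; apply: mx_opnorm_le; first exact: sqrtr_ge0.
move=> x; rewrite sqr_sqrtr ?opnorm_ge0//.
have [f fP xf] := gram_schmidt (codom x).
have {}xf j : x j = \sum_(p < size (codom x)) ip (x j) (f p) *: f p.
  exact/xf/codom_f.
set N := size (codom x) in xf.
pose w (p : 'I_N) j : Fs mu e := ip (x j) (f p) *: one.
pose v i p := \sum_(j < m) A i j (w p j).
have rowE i : \sum_(j < m) map_mx (fun A : 'B(Fs mu e) => Phi (A one)) A i j (x j) =
    \sum_(p < N) Phi (v i p) (f p).
  under [RHS]eq_bigr do rewrite /v (linear_fsum _ _ _ (Phi_linear _)).
  rewrite [RHS]exchange_big; apply: eq_bigr => j _; rewrite mxE.
  rewrite {1}(xf j) linear_sum; apply: eq_bigr => p _.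
  by rewrite /w !linearZ /= (linear_fZ _ _ (Phi_linear _)).
under eq_bigr do rewrite rowE.
apply: (@le_trans _ _ (\sum_(i < m) opnorm S * \sum_(p < N) rnorm (v i p) ^+ 2)).
  by apply: ler_sum => i _; exact: Phi_row.
rewrite -mulr_sumr ler_wpM2l ?opnorm_ge0// exchange_big /=.
apply: (@le_trans _ _ (\sum_(p < N) \sum_(j < m) rnorm (w p j) ^+ 2)).
  by apply: ler_sum => p _; exact: mx_opnorm_le1.
rewrite exchange_big; apply: ler_sum => j _.
under eq_bigr do rewrite /w rnormZ rnorm_one mulr1.
have [f_orth f1] := fP.
apply: (@bessel _ _ _ (fun p : 'I_N => f p)); last exact: index_enum_uniq.
  by move=> p q pq; exact: f_orth.
by move=> p; case: (f1 p) => ->; rewrite ?rnorm0.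
Qed.

Variable Psi : 'B(Fs mu e) -> 'B(H).
Hypothesis PsiE : forall A, D A -> Psi A = Phi (A one).

Let D_sub : subalgebra D.
Proof. exact: wstar_algebra_subalgebra. Qed.

Let D_comm A : D A -> commutant B A.
Proof. exact: Fs_infty_comm. Qed.

Let D_word (a : word n) : D (wordpow B a).
Proof.
by apply: subalgebra_wordpow => // i; apply: sub_wstar_algebra; exists i.
Qed.

Lemma calculus_polynomial (m : nat) (c : word n -> R[i]) :
  Psi (\sum_(a \in [set a : word n | (size a <= m)%N]) c a *: wordpow B a) =
  \sum_(a \in [set a : word n | (size a <= m)%N]) c a *: wordpow T a.
Proof.
rewrite !fsbig_finite; try exact: finite_words.
rewrite PsiE; last exact: (@subalgebra_sum _ _ _ _ _ _ _ D_sub D_word).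
apply: bop_ext => h.
rewrite !bop_sumE (linear_fsum _ _ _ (Phi_linear _)); apply: eq_bigr => a _.
rewrite !bopZE (linear_fZ _ _ (Phi_linear _)) (wordpowE (Bop_comm mu_adm e_basis)).
by rewrite (monom_Bop_vacuum mu_adm e_basis) Phi_ys (wordpowE TC).
Qed.

Lemma calculus_wot : @seq_continuous_on (wot (Fs mu e)) (wot H) D Psi.
Proof.
move=> A A0 DA DA0 AA0; apply/cvg_wotP => h g.
rewrite (PsiE DA0); have [w wP] := Phi_riesz Phi_linear PhiC h g.
have -> : (fun k => ip ((Psi \o A) k h) g) = (fun k => ip (A k one) w).
  by apply/funext => k; rewrite /= (PsiE (DA k)) wP.
by rewrite wP; move/cvg_wotP : AA0; apply.
Qed.

Lemma calculus_sot : @seq_continuous_on (sot (Fs mu e)) (sot H) D Psi.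
Proof.
move=> A A0 DA DA0 AA0; apply/cvg_sotP => h.
rewrite (PsiE DA0).
have -> : (fun k => (Psi \o A) k h) = (fun k => Phi (A k one) h).
  by apply/funext => k; rewrite /= (PsiE (DA k)).
apply: (Phi_cvg Phi_linear PhiC).
by move/cvg_sotP : AA0; apply.
Qed.

Lemma calculus_hom : algebra_hom D Psi.
Proof.
have [D1 DL DM] := D_sub; split.
- by rewrite PsiE// bop1E (Phi_one Phi_ys).
- move=> a A A' DA DA'; rewrite PsiE ?(PsiE DA) ?(PsiE DA'); last exact: DL.
  by rewrite bopDE bopZE (Phi_linearP Phi_linear).
- move=> A A' DA DA'; rewrite PsiE ?(PsiE DA) ?(PsiE DA'); last exact: DM.
  rewrite bopME (Phi_mul mu_adm e_basis TC Phi_linear PhiC Phi_ys)//.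
  exact: D_comm.
Qed.

Lemma calculus_cb : (cb_norm D Psi <= (Num.sqrt (opnorm S))%:E)%E.
Proof.
apply: ge_ereal_sup => _ [m [A [DA A1 ->]]]; rewrite lee_fin.
rewrite (_ : map_mx Psi A = map_mx (fun A : 'B(Fs mu e) => Phi (A one)) A).
  exact: mx_opnorm_Phi.
by apply/matrixP => i j; rewrite !mxE PsiE.
Qed.

Lemma calculus_wstar :
  {within (D : set (wstar (Fs mu e))), continuous (Psi : wstar (Fs mu e) -> wstar H)}.
Proof.
apply/subspace_continuousP => A DA.
apply/cvg_initial_ptws => -[x y].
have [w wP] := wstar_functional x y (sqrtr_ge0 _) Phi_linear PhiC.
rewrite /from_subspace /= (PsiE DA) wP.
have wc : (fun A' : wstar (Fs mu e) => ip (A' one) w : R[i]^o) @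
    within D (nbhs (A : wstar (Fs mu e))) --> (ip (A one) w : R[i]^o).
  apply: (@cvg_wstar_ip _ _ (wstar (Fs mu e)) _ _ id); exact: cvg_within.
(* The formula for [Psi] holds on [D] only, so the functions are identified within [D]. *)
apply: cvg_trans wc; apply: near_eq_cvg.
have inD : \forall A' \near within D (nbhs (A : wstar (Fs mu e))), D A'.
  exact: withinT.
by apply: filterS inD => A' DA'; rewrite -wP (PsiE DA').
Qed.

(** The inverse [B'] of [A - l] is not claimed to lie in [F_s^infty], so its image is taken as
    [Phi (B' one)], and [Phi_mul] is applied on the commutant. *)
Lemma calculus_spectrum A : D A -> spectrum (Psi A) `<=` spectrum A.
Proof.
rewrite /spectrum => DA l /= l_spec [B' [BA AB]]; apply: l_spec.
rewrite (PsiE DA).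
pose M := A - l *: (1 : 'B(Fs mu e)).
have MC : commutant B M.
  move=> i; rewrite /M mulrBl mulrBr (D_comm DA) bop_scalerAl bop_scalerAr.
  by rewrite mul1r mulr1.
(* With [M B' = B' M = 1]: [B' B_i = B' B_i M B' = B' M B_i B' = B_i B']. *)
have BC : commutant B B'.
  move=> i; rewrite -[LHS]mulr1 -AB -/M !mulrA -[B' * _ * _]mulrA -MC.
  by rewrite mulrA BA mul1r.
have PhiM : Phi (M one) = Phi (A one) - l *: (1 : 'B(H)).
  rewrite /M bopDE bopNE bopZE bop1E -(Phi_one Phi_ys).
  by rewrite -scaleNr addrC (Phi_linearP Phi_linear) scaleNr addrC.
have PhiMul := Phi_mul mu_adm e_basis TC Phi_linear PhiC Phi_ys.
exists (Phi (B' one)); rewrite -PhiM -!PhiMul// -!bopME BA AB bop1E.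
by rewrite (Phi_one Phi_ys).
Qed.

End CalculusProperties.

Theorem theorem7p2 (R : realType) (n : nat) (n_gt0 : (0 < n)%N)
    (mu : word n -> R) (mu_adm : admissible_weights mu)
    (F : hilbertType R) (e : word n -> F) (e_basis : orthonormal_basis e)
    (H : hilbertType R) (H_sep : separable H)
    (T : 'I_n -> 'B(H)) (T_Dc : Dc mu T) :
  (exists Psi : 'B(Fs mu e) -> 'B(H), is_calculus T Psi) /\
  forall Psi : 'B(Fs mu e) -> 'B(H), is_calculus T Psi ->
  [/\ forall (m : nat) (c : word n -> R[i]),
        Psi (\sum_(a \in [set a : word n | (size a <= m)%N])
               c a *: wordpow (Bop_s mu e) a) =
        \sum_(a \in [set a : word n | (size a <= m)%N]) c a *: wordpow T a,
      @seq_continuous_on (wot (Fs mu e)) (wot H) (Fs_infty mu e) Psi /\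
      @seq_continuous_on (sot (Fs mu e)) (sot H) (Fs_infty mu e) Psi,
      [/\ algebra_hom (Fs_infty mu e) Psi,
          completely_bounded (Fs_infty mu e) Psi &
          exists2 S : 'B(H),
            wot_sum (fun k : mindex n =>
              (omega mu k)%:C *: (monom T k * adj (monom T k))) S &
            (cb_norm (Fs_infty mu e) Psi <= (Num.sqrt (opnorm S))%:E)%E],
      {within (Fs_infty mu e : set (wstar (Fs mu e))),
        continuous (Psi : wstar (Fs mu e) -> wstar H)} &
      forall A : 'B(Fs mu e), Fs_infty mu e A ->
        spectral_radius (Psi A) <= spectral_radius A].
Proof.
have [TC [S TS]] := T_Dc.
have [Phi [Phi_linear PhiC Phi_ys]] := poisson_map_exists mu_adm TC TS e_basis.
split.
  by eexists; exact: (calculus_exists mu_adm e_basis Phi_linear PhiC Phi_ys).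
move=> Psi PsiP.
have PsiE := calculus_unique mu_adm e_basis Phi_linear PhiC Phi_ys PsiP.
have cb := calculus_cb mu_adm e_basis TC TS Phi_linear PhiC Phi_ys PsiE.
split.
- exact: (calculus_polynomial mu_adm e_basis TC Phi_linear Phi_ys PsiE).
- split; first exact: (calculus_wot Phi_linear PhiC PsiE).
  exact: (calculus_sot Phi_linear PhiC PsiE).
- split; first exact: (calculus_hom mu_adm e_basis TC Phi_linear PhiC Phi_ys PsiE).
    exact: le_lt_trans cb (ltry _).
  by exists S => //; exact: wot_sum_monom.
- exact: (calculus_wstar Phi_linear PhiC PsiE).
- move=> A DA; apply: spectral_radius_le.
  exact: (calculus_spectrum mu_adm e_basis TC Phi_linear PhiC Phi_ys PsiE).
Qed.
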